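(* Let $d\ge1$ and let $X$ be the subordinate random walk in $\mathbb{Z}^d$ associated with a complete Bernstein function $\phi$ (with $\phi(1)=1$). Assume there exist $0<\gamma_1<1$ and $a_1>0$ such that $\phi(R)/\phi(r)\ge a_1(R/r)^{\gamma_1}$ for all $0<r\le R\le1$. If $d\le2$, assume additionally that there exist $\gamma_2$ with $\gamma_1\le\gamma_2<1$ and $\gamma_2<d/2$, and $a_2>0$, such that $\phi(R)/\phi(r)\le a_2(R/r)^{\gamma_2}$ for all $0<r\le R\le1$. Then there exist constants $c_1,c_2>0$ such that the Green function $G$ of $X$ satisfies $$\frac{c_1}{|x|^d\phi(|x|^{-2})}\le G(x)\le\frac{c_2}{|x|^d\phi(|x|^{-2})}\quad\text{for all } x\in\mathbb{Z}^d,\ |x|\ge1.$$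
   Context: A complete Bernstein function here is $\phi(\lambda)=\int_{(0,\infty)}(1-e^{-\lambda t})\,\mu(dt)$, $\lambda>0$, where $\int_{(0,\infty)}(1\wedge t)\,\mu(dt)<\infty$ and $\mu$ has a completely monotone density with respect to Lebesgue measure; it is normalized by $\phi(1)=1$. Subordinate random walk: let $Z=(Z_n)_{n\ge0}$ be the simple symmetric random walk in $\mathbb{Z}^d$ started at the origin (each step is $\pm e_i$ with probability $1/(2d)$). For $m\in\mathbb{N}$ put $c_m^\phi=\int_{(0,\infty)}\frac{t^m}{m!}e^{-t}\mu(dt)$; then $\sum_{m\ge1}c_m^\phi=\phi(1)=1$. Let $(R_k)_{k\ge1}$ be i.i.d., independent of $Z$, with $\mathbb{P}(R_k=m)=c_m^\phi$, $m\in\mathbb{N}$; set $T_n=\sum_{k=1}^nR_k$ (with $T_0=0$) and $X_n=Z_{T_n}$. The Green function of $X$ is $G(y)=\mathbb{E}\big[\sum_{n=0}^\infty\mathbf{1}_{\{X_n=y\}}\big]$, $y\in\mathbb{Z}^d$. $|\cdot|$ is the Euclidean norm. *)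

(* Defs.v *)
From HB Require Import structures.
From mathcomp Require Import all_boot all_order all_algebra.
From mathcomp Require Import finmap.
From mathcomp Require Import all_classical all_reals all_analysis.

Set Implicit Arguments.
Unset Strict Implicit.
Unset Printing Implicit Defensive.

Import Order.TTheory GRing.Theory Num.Theory.
Import numFieldNormedType.Exports.

Local Open Scope classical_set_scope.
Local Open Scope ring_scope.

Definition completely_monotone (R : realType) (f : R -> R) : Prop :=
  forall (n : nat) (t : R), 0 < t ->
    derivable (derive1n n f) t 1 /\ 0 <= (-1) ^+ n * derive1n n f t.

(* Only the trace of [mu] on ]0, +oo[ matters, here and in every integral
   below. *)
Definition has_cm_density (R : realType)
    (mu : {measure set (measurableTypeR R) -> \bar R}) : Prop :=
  exists f : R -> R, completely_monotone f /\
    forall A : set (measurableTypeR R), measurable A -> A `<=` `]0, +oo[ ->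
      mu A = (\int[lebesgue_measure]_(t in A) (f t)%:E)%E.

(* [mu] is the (unique) Levy measure of [phi]; the values of [phi] outside
   ]0, +oo[ are unconstrained. *)
Definition complete_bernstein (R : realType) (phi : R -> R)
    (mu : {measure set (measurableTypeR R) -> \bar R}) : Prop :=
  [/\ has_cm_density mu,
      (\int[mu]_(t in `]0%R, +oo[) (Num.min 1 t)%:E < +oo)%E
    & forall lam : R, 0 < lam ->
      (phi lam)%:E =
        (\int[mu]_(t in `]0%R, +oo[) (1 - expR (- (lam * t)))%:E)%E].

Definition jump_weight (R : realType)
    (mu : {measure set (measurableTypeR R) -> \bar R}) (m : nat) : \bar R :=
  (\int[mu]_(t in `]0%R, +oo[) (t ^+ m / m`!%:R * expR (- t))%:E)%E.

Section Walks.
Context {disp : measure_display} {Omega : measurableType disp} {R : realType}.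
Variable P : probability Omega R.

(* Countable state spaces carry the discrete sigma-algebra. *)
Definition discrete_process (T : Type) (X : nat -> Omega -> T) : Prop :=
  forall (n : nat) (B : set T), measurable (X n @^-1` B).

Definition mutually_independent (T : Type) (X : nat -> Omega -> T) : Prop :=
  forall (I : {fset nat}) (B : nat -> set T),
    P (\bigcap_(k in [set` I]) (X k @^-1` B k)) =
      (\prod_(k <- I) P (X k @^-1` B k))%E.

Definition sigma_of (T : Type) (X : nat -> Omega -> T) : set_system Omega :=
  <<s [set A | exists (n : nat) (B : set T), A = X n @^-1` B] >>.

Definition independent_processes (T U : Type) (X : nat -> Omega -> T)
    (Y : nat -> Omega -> U) : Prop :=
  forall A B : set Omega, sigma_of X A -> sigma_of Y B ->
    P (A `&` B) = (P A * P B)%E.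

(* Points of Z^d are row vectors; [delta_mx 0 i] is the basis vector e_i. *)
Definition simple_random_walk (d : nat) (Z : nat -> Omega -> 'rV[int]_d) :
    Prop :=
  let step (n : nat) (w : Omega) := Z n.+1 w - Z n w in
  [/\ discrete_process Z,
      forall w, Z 0%N w = 0,
      mutually_independent step
    & forall (n : nat) (i : 'I_d),
        P (step n @^-1` [set delta_mx 0 i]) = ((2 * d)%:R^-1)%:E /\
        P (step n @^-1` [set - delta_mx 0 i]) = ((2 * d)%:R^-1)%:E].

(* [J k] is the (k+1)-st jump, so that T_n = J 0 + ... + J (n-1). The law
   is prescribed on m >= 1, where its total mass is phi(1) = 1. *)
Definition subordinate_random_walk (d : nat)
    (mu : {measure set (measurableTypeR R) -> \bar R})
    (X : nat -> Omega -> 'rV[int]_d) : Prop :=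
  exists (Z : nat -> Omega -> 'rV[int]_d) (J : nat -> Omega -> nat),
    [/\ simple_random_walk Z,
        discrete_process J /\ mutually_independent J,
        forall k m : nat, (1 <= m)%N ->
          P (J k @^-1` [set m]) = jump_weight mu m,
        independent_processes Z J
      & forall (n : nat) (w : Omega), X n w = Z (\sum_(k < n) J k w)%N w].

Definition green (d : nat) (X : nat -> Omega -> 'rV[int]_d) (y : 'rV[int]_d) :
    \bar R :=
  (\int[P]_w \sum_(0 <= n <oo) (\1_(X n @^-1` [set y]) w)%:E)%E.

End Walks.

Definition enorm (R : realType) (d : nat) (x : 'rV[int]_d) : R :=
  Num.sqrt (\sum_(i < d) ((x 0 i)%:~R) ^+ 2).

(* Main.v *)
Require Import Defs.
From HB Require Import structures.
From mathcomp Require Import all_boot all_order all_algebra.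
From mathcomp Require Import finmap.
From mathcomp Require Import all_classical all_reals all_analysis.
From mathcomp Require Import measurable_realfun.
From mathcomp Require Import ring lra zify.

(** Write N for |x|^2, which is a positive integer, p_m(x) for P(Z_m = x), and
    u_m for the sum over n of P(T_n = m), the renewal sequence of the law c of
    the jumps.  As the clock T is independent of Z, G(x) is the sum over m of
    u_m p_m(x) [green_series].  At large times m of order N and of the right
    parity the heat kernel p_m(x) is of order N^(-d/2), and it is always at most
    a constant times min(N^(-d/2), m^(-d/2)).  So no pointwise asymptotics of u are called for:
    two-sided bounds on the mass that u gives to long intervals are enough.

    The mass of u.  The generating function of c is 1 - phi(1 - s), hence that
    of u is 1 / phi(1 - s) [gf_renewal_cvg].  Evaluating it at distance of order
    1/N from 1 bounds the mass of [0, N] by 4 / phi(1/N) [renewal_mass_le].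
    Conversely, by the lower scaling of phi, [0, N] carries only a small part of
    the mass 1 / phi(1/(KN)) seen at the scale KN once K is large, and the
    concavity of phi makes the part beyond 14KN small as well; so the
    times in between carry at least 1 / (2 phi(1/N)) [renewal_mass_ge].

    The heat kernel.  A step of the lattice walk first chooses an axis; given
    how many steps fall on each axis, the coordinates are independent walks on
    the line.  This gives a recursion on the dimension, through binomial sums
    [srw, srw_law].  The upper bounds come from one-dimensional ones by
    Cauchy-Schwarz and an exact summation of binomial coefficients [srw_upper],
    the lower bound from Chebyshev's inequality for the number of steps along
    the last axis [srw_lower].

    Parity.  p_m(x) vanishes unless m has the parity of the sum of the
    coordinates of x, so the lower bound needs mass of u on one parity class.
    It is there because u_(m+1) >= c_1 u_m with c_1 > 0 [renewal_parity].

    Conclusion.  For the lower bound one sums over the m of the right parity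
    between M0 N and 14 K M0 N + 1.  For the upper bound, the m <= N contribute at
    most N^(-d/2) times the mass of [0, N]; the m > N are cut into dyadic
    blocks, whose contributions decay geometrically because
    phi(1/N) / phi(1/(2^j N)) grows more slowly than 2^(j d/2)
    [weighted_sum_le, phi_dyadic_growth]: for d <= 2 by the upper scaling, for
    d >= 3 by concavity alone. *)

Set Implicit Arguments.
Unset Strict Implicit.
Unset Printing Implicit Defensive.

Import Order.TTheory GRing.Theory Num.Theory.
Import numFieldNormedType.Exports.

Local Open Scope classical_set_scope.
Local Open Scope ring_scope.

(** * Binomial sums *)

Section BinomialSums.
Variable R : realType.

(** The sum over the ways of splitting m steps between two axes; the two
    arguments of F are the numbers of steps on each. *)
Definition binsum (m : nat) (F : nat -> nat -> R) : R :=
  \sum_(k < m.+1) 'C(m, k)%:R * F k (m - k)%N.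

Lemma eq_binsum m F G : (forall k j, (k + j)%N = m -> F k j = G k j) ->
  binsum m F = binsum m G.
Proof.
move=> FG; apply: eq_bigr => k _; rewrite FG //.
by rewrite subnKC // -ltnS.
Qed.

Lemma ler_binsum m F G : (forall k j, (k + j)%N = m -> F k j <= G k j) ->
  binsum m F <= binsum m G.
Proof.
move=> FG; apply: ler_sum => k _; apply: ler_wpM2l => //; apply: FG.
by rewrite subnKC // -ltnS.
Qed.

Lemma binsumD m F G :
  binsum m (fun k j => F k j + G k j) = binsum m F + binsum m G.
Proof. by rewrite -big_split; apply: eq_bigr => k _; rewrite /= mulrDr. Qed.

Lemma binsumZ m a F : binsum m (fun k j => a * F k j) = a * binsum m F.
Proof. by rewrite mulr_sumr; apply: eq_bigr => k _; rewrite mulrCA. Qed.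

(** Leibniz rule for such sums, by conditioning on the axis of the last step.
    Every identity below follows from it by induction on m. *)
Lemma binsumS m F :
  binsum m.+1 F = binsum m (fun k j => F k j.+1 + F k.+1 j).
Proof.
rewrite binsumD /binsum big_ord_recl /= bin0 mul1r subn0.
under eq_bigr => k _ do rewrite /bump /= add1n subSS binS natrD mulrDl.
rewrite big_split /= [X in _ + (X + _)]big_ord_recr /= bin_small // mul0r addr0.
rewrite addrA; congr (_ + _).
rewrite [RHS]big_ord_recl /= bin0 mul1r subn0; congr (_ + _).
by apply: eq_bigr => k _; rewrite /bump /= add1n subnSK.
Qed.

Lemma binsum_exp m a b : binsum m (fun k j => a ^+ k * b ^+ j) = (a + b) ^+ m.
Proof.
elim: m => [|m IH].
  by rewrite /binsum big_ord_recl big_ord0 /= bin0 subnn !expr0 !mulr1 addr0.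
rewrite binsumS exprS -IH -binsumZ; apply: eq_binsum => k j _.
by rewrite !exprS; ring.
Qed.

(** The variance of a binomial variable of parameter 1/(d+1), without
    normalization. The induction needs a free shift e, because passing from m to
    m.+1 moves the centre. *)
Lemma binsum_var m (d : nat) :
  binsum m (fun k j => d%:R ^+ j * (d.+1%:R * k%:R - m%:R) ^+ 2) =
  (m * d)%:R * d.+1%:R ^+ m.
Proof.
suff H e : binsum m (fun k j => d%:R ^+ j * (d.+1%:R * k%:R - m%:R + e) ^+ 2)
    = (m%:R * d%:R + e ^+ 2) * d.+1%:R ^+ m.
  have := H 0; rewrite expr0n addr0 natrM => <-.
  by apply: eq_binsum => k j _; rewrite addr0.
elim: m e => [|m IH] e.
  by rewrite /binsum big_ord_recl big_ord0 /= bin0 expr0 mulr0 subr0; ring.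
have -> : (m.+1%:R * d%:R + e ^+ 2) * d.+1%:R ^+ m.+1 =
   d%:R * ((m%:R * d%:R + (e - 1) ^+ 2) * d.+1%:R ^+ m) +
   (m%:R * d%:R + (e + d%:R) ^+ 2) * d.+1%:R ^+ m :> R.
  by rewrite [_ ^+ m.+1]exprS -!natr1; ring.
rewrite -!IH -binsumZ -binsumD binsumS; apply: eq_binsum => k j _.
by rewrite [_ ^+ j.+1]exprS -!natr1; ring.
Qed.

End BinomialSums.

(** * Simple random walk on the line *)

Section OneDim.
Variable R : realType.

Fixpoint srw1 (n : nat) (y : int) : R :=
  if n is n'.+1 then (srw1 n' (y - 1) + srw1 n' (y + 1)) / 2
  else (y == 0)%:R.

Lemma srw1_ge0 n y : 0 <= srw1 n y.
Proof.
elim: n y => [|n IH] y /=; first exact: ler0n.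
by rewrite divr_ge0 ?addr_ge0.
Qed.

Lemma srw1N n y : srw1 n (- y) = srw1 n y.
Proof.
elim: n y => [|n IH] y /=; first by rewrite oppr_eq0.
have -> : - y - 1 = - (y + 1) by lia.
have -> : - y + 1 = - (y - 1) by lia.
by rewrite !IH addrC.
Qed.

Lemma srw1_far n (y : int) : n%:Z < y -> srw1 n y = 0.
Proof.
elim: n y => [|n IH] y /= hy; first by rewrite gt_eqF.
by rewrite !IH ?addr0 ?mul0r //; lia.
Qed.

Lemma srw1_parity n y : ~~ (2 %| n%:Z - y)%Z -> srw1 n y = 0.
Proof.
elim: n y => [|n IH] y /= hy.
  by case: eqP => // y0; move: hy; rewrite y0.
rewrite !IH ?addr0 ?mul0r //.
  by apply: contra hy => /dvdzP[q hq]; apply/dvdzP; exists (q + 1); lia.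
by apply: contra hy => /dvdzP[q hq]; apply/dvdzP; exists q; lia.
Qed.

Lemma srw1_binE n a : srw1 n (n%:Z - a.*2%:Z) = 'C(n, a)%:R / 2 ^+ n.
Proof.
elim: n a => [|n IH] [|a] /=.
- by rewrite bin0 expr0 divr1.
- by rewrite bin_small // mul0r.
- have -> : n.+1%:Z - 0%N.*2%:Z - 1 = n%:Z - 0%N.*2%:Z by lia.
  by rewrite IH srw1_far ?bin0 ?exprS ?addr0; [field; rewrite expf_neq0|lia].
have -> : n.+1%:Z - a.+1.*2%:Z - 1 = n%:Z - a.+1.*2%:Z by lia.
have -> : n.+1%:Z - a.+1.*2%:Z + 1 = n%:Z - a.*2%:Z by lia.
by rewrite !IH binS natrD exprS; field; rewrite expf_neq0.
Qed.

(** By symmetry and parity, the values of srw1 are 0 or the binomial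
    probabilities of srw1_binE with a in the first half of the row. *)
Lemma srw1_cases n y : srw1 n y = 0 \/
  exists2 a : nat, (a.*2 <= n)%N & `|y| = n%:Z - a.*2%:Z.
Proof.
have [h|h] := boolP (2 %| n%:Z - `|y|)%Z; last first.
  left; rewrite -(@srw1_parity n `|y|) //.
  by case: (ger0P y) => // _; rewrite srw1N.
have [h1|h1] := ltP n%:Z `|y|.
  left; rewrite -(@srw1_far n `|y|) //.
  by case: (ger0P y) => // _; rewrite srw1N.
by right; case/dvdzP: h => q hq; exists `|q|%N; lia.
Qed.

Lemma srw1_abs n y : srw1 n `|y| = srw1 n y.
Proof. by case: (ger0P y) => // _; rewrite srw1N. Qed.

(** The largest binomial probability. It takes the same value at 2k+1 and 2k+2,
    so its square times n+1 is controlled by Wallis's product along odd n. *)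
Definition central_prob n : R := 'C(n, n./2)%:R / 2 ^+ n.

Lemma central_prob_even k : central_prob k.*2.+2 = central_prob k.*2.+1.
Proof.
rewrite /central_prob /= uphalf_double doubleK binS.
have -> : 'C(k.*2.+1, k.+1) = 'C(k.*2.+1, k).
  by rewrite -[RHS]bin_sub; [congr 'C(_, _); lia|lia].
by rewrite natrD exprS; field; rewrite expf_neq0.
Qed.

Lemma central_prob_odd k : central_prob k.*2.+3 = central_prob k.*2.+1 * ((k.*2 + 3)%:R / (k.*2 + 4)%:R).
Proof.
rewrite -central_prob_even /central_prob /= !uphalf_double !doubleK exprS.
have : (k.*2.+3 * 'C(k.*2.+2, k.+1) = k.+2 * 'C(k.*2.+3, k.+1))%N.
  by have := mul_bin_down k.*2.+3 k.+1; rewrite (_ : k.*2.+3 - k.+1 = k.+2)%N //; lia.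
move/(congr1 (fun n => n%:R : R)); rewrite !natrM => h.
have k2 : k.+2%:R != 0 :> R by rewrite pnatr_eq0.
have -> : 'C(k.*2.+3, k.+1)%:R = k.*2.+3%:R * 'C(k.*2.+2, k.+1)%:R / k.+2%:R :> R.
  by rewrite h mulrAC mulfV ?mul1r.
have -> : (k.*2 + 4)%:R = 2 * k.+2%:R :> R by rewrite -natrM; congr (_%:R); lia.
have -> : (k.*2 + 3)%N = k.*2.+3 by lia.
clear h; move: k.+2%:R k2 k.*2.+3%:R => u u0 v.
by field; rewrite u0 expf_neq0.
Qed.

Lemma central_prob_bounds_odd k :
  central_prob k.*2.+1 ^+ 2 * (k.*2 + 3)%:R <= 1 <= central_prob k.*2.+1 ^+ 2 * (4 * k.+1)%:R.
Proof.
elim: k => [|k]; first by rewrite /central_prob /= bin0 expr1 double0 add0n muln1; apply/andP; split; lra.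
rewrite doubleS central_prob_odd; move: (central_prob _) => w /andP[h1 h2].
have k0 : 0 <= k%:R :> R by [].
have e i : (k.*2 + i)%:R = 2 * k%:R + i%:R :> R by rewrite natrD -mul2n natrM.
have ei : (k.*2.+2 + 3)%:R = 2 * k%:R + 5 :> R.
  by rewrite -e; congr (_%:R); lia.
have e1 : (4 * k.+1)%:R = 4 * k%:R + 4 :> R by rewrite natrM -natr1; ring.
have e2 : (4 * k.+2)%:R = 4 * k%:R + 8 :> R by rewrite natrM -!natr1; ring.
rewrite ei e2 !e in h1 *; rewrite e1 in h2.
move: k%:R k0 h1 h2 {ei e1 e2 e} => x x0 h1 h2.
have x4 : 0 < (2 * x + 4%:R) ^+ 2 by nra.
rewrite exprMn expr_div_n; apply/andP; split.
  have -> : w ^+ 2 * ((2 * x + 3%:R) ^+ 2 / (2 * x + 4%:R) ^+ 2) * (2 * x + 5)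
    = (w ^+ 2 * (2 * x + 3%:R)) * ((2 * x + 3) * (2 * x + 5)) / (2 * x + 4%:R) ^+ 2.
    by field; lra.
  by rewrite ler_pdivrMr // mul1r; nra.
have -> : w ^+ 2 * ((2 * x + 3%:R) ^+ 2 / (2 * x + 4%:R) ^+ 2) * (4 * x + 8)
    = (w ^+ 2 * (4 * x + 4)) * ((2 * x + 3) ^+ 2) / (2 * x + 4%:R) ^+ 2 * ((x+2)/(x+1)).
  by field; lra.
rewrite mulrA ler_pdivlMr ?mul1r; last lra.
rewrite mulrAC ler_pdivlMr //.
have : 0 <= (w ^+ 2 * (4 * x + 4) - 1) * ((2 * x + 3) ^+ 2 * (x + 2)).
  by rewrite mulr_ge0 ?subr_ge0 //; nra.
nra.
Qed.

Lemma central_prob_bounds n : central_prob n ^+ 2 * n.+1%:R <= 1 <= 4 * (central_prob n ^+ 2 * n.+1%:R).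
Proof.
have [k hk] : exists k, [\/ n = 0%N, n = k.*2.+1 | n = k.*2.+2].
  case: n => [|n]; first by exists 0%N; constructor 1.
  exists n./2; have := odd_double_half n.
  by case: (odd n) => h; [constructor 3|constructor 2]; rewrite -[in LHS]h.
have /andP[h1 h2] := central_prob_bounds_odd k.
have e3 : (k.*2 + 3)%:R = 2 * k%:R + 3 :> R by rewrite natrD -mul2n natrM.
have e1 : (4 * k.+1)%:R = 4 * k%:R + 4 :> R by rewrite natrM -natr1; ring.
have k0 : 0 <= k%:R :> R by [].
rewrite {}e3 {}e1 in h1 h2.
have w0 := sqr_ge0 (central_prob k.*2.+1).
case: hk => ->.
- by rewrite /central_prob /= bin0 expr0 divr1; apply/andP; split; lra.
- have -> : k.*2.+2%:R = 2 * k%:R + 2 :> R by rewrite -!natr1 -mul2n natrM; ring.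
  by apply/andP; split; nra.
have -> : k.*2.+3%:R = 2 * k%:R + 3 :> R by rewrite -!natr1 -mul2n natrM; ring.
by rewrite central_prob_even; apply/andP; split; nra.
Qed.

(** The ratio of neighbouring binomials at height y is 1 - (2y+2)/(n+y+2), at
    most exp(-(y+1)/(n+1)), and the product of these exponentials telescopes to
    a Gaussian. *)
Lemma bin_le_gauss n j : (j <= n./2)%N ->
  'C(n, n./2 - j)%:R <= 'C(n, n./2)%:R *
    expR ((1 - (odd n + j.*2)%:R ^+ 2) / (4 * n.+1%:R)) :> R.
Proof.
have n0 : 0 < n.+1%:R :> R by [].
elim: j => [|j IH] hj.
  rewrite subn0 ler_peMr // -[leLHS]expR0 ler_expR divr_ge0 ?mulr_ge0 ?addn0 //.
  by rewrite subr_ge0; rewrite expr_le1 // lern1; case: (odd n).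
have {}IH := IH (ltnW hj).
set y : nat := (odd n + j.*2)%N in IH.
have ey : (odd n + j.+1.*2)%N = (y + 2)%N by rewrite /y; lia.
have hb : ((n./2 - j.+1).+1 = n./2 - j)%N by lia.
have := mul_bin_left n (n./2 - j.+1); rewrite hb.
have -> : (n - (n./2 - j.+1) = (n./2 - j) + y + 1)%N.
  by rewrite /y; have := odd_double_half n; lia.
have : ((n./2 - j).*2 + y = n)%N by rewrite /y; have := odd_double_half n; lia.
set a := (n./2 - j)%N in IH hb *; set b := (n./2 - j.+1)%N in hb *.
move=> hn; move/(congr1 (fun n => n%:R : R)); rewrite !natrM => hC.
have hn' : n%:R = 2 * a%:R + y%:R :> R by rewrite -hn natrD -mul2n natrM.
have a0 : 0 < a%:R :> R by rewrite ltr0n /a; lia.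
clearbody y a b; have y0 : 0 <= y%:R :> R by [].
have {hC} -> : 'C(n, b)%:R = 'C(n, a)%:R * (a%:R / (a + y + 1)%:R) :> R.
  have p1 : (a + y + 1)%:R != 0 :> R by rewrite pnatr_eq0; lia.
  by rewrite -[LHS](mulKf p1) -hC mulrC -mulrA mulrCA.
have -> : (1 - (odd n + j.+1.*2)%:R ^+ 2) / (4 * n.+1%:R) =
   (1 - y%:R ^+ 2) / (4 * n.+1%:R) + - ((y%:R + 1) / n.+1%:R) :> R.
  by rewrite ey natrD; field; lra.
rewrite expRD [leRHS]mulrA; apply: ler_pM => //.
apply: le_trans (expR_ge1Dx _).
rewrite -[n.+1%:R]natr1 in n0 *; rewrite !natrD hn' in n0 *.
clear - a0 y0 n0; move: a%:R y%:R a0 y0 n0 => {}a {}y a0 y0 n0.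
rewrite ler_pdivrMr; last lra.
have -> : (1 - (y + 1) / (2 * a + y + 1)) * (a + y + 1) =
  (2 : R) * a * (a + y + 1) / (2 * a + y + 1).
  by field; lra.
by rewrite ler_pdivlMr //; nra.
Qed.

Lemma expR_ge_1B (t : R) : 0 <= t -> t <= 1 / 2 -> expR (- (2 * t)) <= 1 - t.
Proof.
move=> t0 t1; have h := expR_ge1Dx (2 * t).
by rewrite expRN -[leLHS]mul1r ler_pdivrMr ?expR_gt0 //; nra.
Qed.

(** Same ratios as in bin_le_gauss; as long as 3(y+2) <= n they are at least
    1/2, where 1 - t >= exp(-2t). *)
Lemma bin_ge_gauss n j : (3 * (odd n + j.*2) <= n)%N ->
  'C(n, n./2)%:R * expR (- ((odd n + j.*2)%:R ^+ 2 / n.+1%:R)) <=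
  'C(n, n./2 - j)%:R :> R.
Proof.
have n0 : 0 < n.+1%:R :> R by [].
elim: j => [|j IH] hj.
  rewrite subn0 ler_piMr // -[leRHS]expR0 ler_expR oppr_le0 divr_ge0 // sqr_ge0 //.
have {}IH := IH ltac:(lia).
set y : nat := (odd n + j.*2)%N in IH.
have ey : (odd n + j.+1.*2)%N = (y + 2)%N by rewrite /y; lia.
have hb : ((n./2 - j.+1).+1 = n./2 - j)%N by lia.
have := mul_bin_left n (n./2 - j.+1); rewrite hb.
have -> : (n - (n./2 - j.+1) = (n./2 - j) + y + 1)%N.
  by rewrite /y; have := odd_double_half n; lia.
have : ((n./2 - j).*2 + y = n)%N by rewrite /y; have := odd_double_half n; lia.
set a := (n./2 - j)%N in IH hb *; set b := (n./2 - j.+1)%N in hb *.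
move=> hn; move/(congr1 (fun n => n%:R : R)); rewrite !natrM => hC.
have hn' : n%:R = 2 * a%:R + y%:R :> R by rewrite -hn natrD -mul2n natrM.
have a0 : 0 < a%:R :> R by rewrite ltr0n /a; lia.
clearbody y a b; have y0 : 0 <= y%:R :> R by [].
have h3 : 3 * (y%:R + 2) <= n%:R :> R.
  by rewrite -natrD -natrM ler_nat; lia.
have {hC} -> : 'C(n, b)%:R = 'C(n, a)%:R * (a%:R / (a + y + 1)%:R) :> R.
  have p1 : (a + y + 1)%:R != 0 :> R by rewrite pnatr_eq0; lia.
  by rewrite -[LHS](mulKf p1) -hC mulrC -mulrA mulrCA.
have -> : - ((odd n + j.+1.*2)%:R ^+ 2 / n.+1%:R) =
   - (y%:R ^+ 2 / n.+1%:R) + - (4 * (y%:R + 1) / n.+1%:R) :> R.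
  by rewrite ey natrD; field; lra.
rewrite expRD [leLHS]mulrA; apply: ler_pM => //.
rewrite -[n.+1%:R]natr1 in n0 *; rewrite !natrD hn' in n0 h3 *.
clear - a0 y0 n0 h3; move: a%:R y%:R a0 y0 n0 h3 => {}a {}y a0 y0 n0 h3.
have p0 : 0 < a + y + 1 by lra.
have -> : a / (a + y + 1) = 1 - (y + 1) / (a + y + 1) :> R.
  by field; lra.
apply: le_trans (expR_ge_1B _ _).
- rewrite ler_expR lerN2 mulrA ler_pdivlMr // mulrAC ler_pdivrMr //; nra.
- by rewrite divr_ge0; lra.
by rewrite ler_pdivrMr //; lra.
Qed.

(** Coordinates for the first half of a row of Pascal's triangle: j steps away
    from the centre, at the lattice point n - 2a. *)
Lemma half_offset n a : (a.*2 <= n)%N ->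
  exists j, [/\ (j <= n./2)%N, a = (n./2 - j)%N & (n - a.*2 = odd n + j.*2)%N].
Proof.
move=> h; exists (n./2 - a)%N; have := odd_double_half n.
by split; lia.
Qed.

Lemma srw1_le_gauss n y : srw1 n y ^+ 2 * n.+1%:R <=
  expR ((1 - (y%:~R) ^+ 2) / (2 * n.+1%:R)).
Proof.
have [->|[a han hy]] := srw1_cases n y; first by rewrite expr0n mul0r expR_ge0.
have [j [hj aj yj]] := half_offset han.
rewrite -srw1_abs hy srw1_binE.
have -> : (y%:~R) ^+ 2 = (odd n + j.*2)%:R ^+ 2 :> R.
  rewrite -[LHS]real_normK ?num_real // -intr_norm hy -yj; congr (_ ^+ 2).
  by rewrite natrB // rmorphB.
have /andP[h1 _] := central_prob_bounds n.
have h2 := bin_le_gauss hj; rewrite -aj in h2.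
apply: le_trans (_ : (central_prob n * expR ((1 - (odd n + j.*2)%:R ^+ 2) / (4 * n.+1%:R))) ^+ 2 * n.+1%:R <= _).
  rewrite ler_wpM2r // ler_sqr ?nnegrE ?divr_ge0 ?mulr_ge0 ?expR_ge0 //.
  by rewrite /central_prob mulrAC ler_wpM2r // invr_ge0.
rewrite exprMn mulrAC -[leRHS]mul1r; apply: ler_pM => //.
- by rewrite mulr_ge0 // sqr_ge0.
rewrite -expRM_natl ler_expR le_eqVlt; apply/orP; left; apply/eqP.
by field; rewrite addrC natr1 pnatr_eq0.
Qed.

Lemma srw1_le_time n y : srw1 n y ^+ 2 * n.+1%:R <= 1.
Proof.
have [->|[a han hy]] := srw1_cases n y; first by rewrite expr0n mul0r.
rewrite -srw1_abs hy srw1_binE; have /andP[h1 _] := central_prob_bounds n.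
apply: le_trans h1; rewrite ler_wpM2r // ler_sqr ?nnegrE ?divr_ge0 //.
rewrite /central_prob ler_wpM2r ?invr_ge0 // ler_nat.
have [j [hj -> _]] := half_offset han.
elim: j hj {a han hy} => [|j IH] hj; first by rewrite subn0.
apply: leq_trans (IH (ltnW hj)).
have := mul_bin_left n (n./2 - j.+1).
have -> : (n./2 - j.+1).+1 = (n./2 - j)%N by lia.
have := odd_double_half n; nia.
Qed.

(** The Gaussian factor beats every power: at distance much larger than sqrt n
    the probability is small to any polynomial order. *)
Lemma srw1_le_poly j n y : srw1 n y ^+ 2 * n.+1%:R * (y%:~R ^+ 2) ^+ j.+1 <=
  (expR (1 / 2) * j.+1`!%:R * 2 ^+ j.+1) * n.+1%:R ^+ j.+1.
Proof.
set Y := y%:~R ^+ 2; have Y0 : 0 <= Y by exact: sqr_ge0.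
have n0 : 0 < n.+1%:R :> R by [].
set z := Y / (2 * n.+1%:R); have z0 : 0 <= z by apply: divr_ge0 => //; apply: mulr_ge0.
have hz : z ^+ j.+1 <= j.+1`!%:R * expR z.
  rewrite mulrC -ler_pdivrMr ?ltr0n ?fact_gt0 //.
  by apply: le_trans (expR_ge1Dxn j z0); rewrite lerDr.
have -> : Y ^+ j.+1 = z ^+ j.+1 * (2 ^+ j.+1 * n.+1%:R ^+ j.+1).
  by rewrite -!exprMn /z mulfVK // mulf_neq0 // gt_eqF.
rewrite [leLHS]mulrA -[leRHS]mulrA ler_wpM2r ?mulr_ge0 ?exprn_ge0 //.
apply: le_trans (_ : expR ((1 - Y) / (2 * n.+1%:R)) * (j.+1`!%:R * expR z) <= _).
  by apply: ler_pM => //; [rewrite mulr_ge0 // sqr_ge0|exact: exprn_ge0|exact: srw1_le_gauss].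
rewrite mulrCA mulrC ler_wpM2r // -expRD ler_expR /z -mulrDl subrK.
rewrite ler_pdivrMr ?mulr_gt0 //.
have : 1 <= n.+1%:R :> R by rewrite ler1n.
lra.
Qed.

(** In the diffusive range y^2 <= B n the Gaussian factor is bounded below; n >=
    9B keeps such y within the range of bin_ge_gauss. *)
Lemma srw1_ge (B : R) n y : 0 <= B -> y%:~R ^+ 2 <= B * n%:R -> 9 * B <= n%:R ->
  (2 %| n%:Z - y)%Z -> expR (- B) / 2 / Num.sqrt n.+1%:R <= srw1 n y.
Proof.
move=> B0 hyB hn hpar.
have n0 : 0 < n.+1%:R :> R by [].
have h3 : (3 * `|y| <= n)%N.
  rewrite -(ler_nat R) natrM natr_absz -ler_sqr ?nnegrE ?mulr_ge0 //.
  rewrite exprMn intr_norm real_normK ?num_real //.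
  have nn : 0 <= n%:R :> R by [].
  by nra.
have [a han hy] : exists2 a : nat, (a.*2 <= n)%N & `|y| = n%:Z - a.*2%:Z.
  by case/dvdzP: hpar => q hq; exists ((n - `|y|)./2)%N; lia.
have [j [hj aj yj]] := half_offset han.
have y2 : (y%:~R) ^+ 2 = (odd n + j.*2)%:R ^+ 2 :> R.
  rewrite -[LHS]real_normK ?num_real // -intr_norm hy -yj; congr (_ ^+ 2).
  by rewrite natrB // rmorphB.
rewrite -srw1_abs hy srw1_binE aj.
have h4 : (3 * (odd n + j.*2) <= n)%N by rewrite -yj; lia.
have /andP[_ h1] := central_prob_bounds n.
apply: le_trans (_ : central_prob n * expR (- B) <= _).
  rewrite -mulrA [leRHS]mulrC ler_wpM2l ?expR_ge0 //.
  rewrite -invfM -[leLHS]div1r ler_pdivrMr ?mulr_gt0 ?sqrtr_gt0 //.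
  rewrite -ler_sqr ?nnegrE ?mulr_ge0 ?divr_ge0 ?sqrtr_ge0 ?invr_ge0 //.
  rewrite expr1n exprMn [(2 * _) ^+ 2]exprMn sqr_sqrtr //.
  by apply: le_trans h1 _; rewrite mulrCA; lra.
rewrite /central_prob mulrAC ler_wpM2r ?invr_ge0 //.
apply: le_trans (bin_ge_gauss h4); rewrite ler_wpM2l // ler_expR lerN2 -y2.
rewrite ler_pdivrMr //; apply: le_trans hyB _; rewrite ler_wpM2l // ler_nat //.
Qed.
End OneDim.

(** * Simple random walk on the lattice *)

Section Walk.
Variable R : realType.

(** In dimension d this is d^m P(Z_m = x), as srw_law shows: k of the m steps
    fall on the last axis, the others on the first d-1 axes. The factor d^m
    removes the probabilities of the axes from the recursion and makes dimension
    0 a valid base case. Points are functions on nat, so that dropping a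
    coordinate changes no type. *)
Fixpoint srw (d : nat) (x : nat -> int) (m : nat) : R :=
  if d is e.+1 then binsum m (fun k j => srw1 R k (x e) * srw e x j)
  else (m == 0)%:R.

Lemma binsum_ge0 m (F : nat -> nat -> R) :
  (forall k j, (k + j)%N = m -> 0 <= F k j) -> 0 <= binsum m F.
Proof.
move=> F0; apply: sumr_ge0 => k _; apply: mulr_ge0 => //; apply: F0.
by rewrite subnKC // -ltnS.
Qed.

Lemma srw_ge0 d x m : 0 <= srw d x m.
Proof.
elim: d m => [|d IH] m /=; first by [].
by apply: binsum_ge0 => k j _; rewrite mulr_ge0 ?srw1_ge0.
Qed.

Lemma eq_srw d x x' m : (forall i, (i < d)%N -> x i = x' i) ->
  srw d x m = srw d x' m.
Proof.
elim: d m => [//|d IH] m h /=; apply: eq_binsum => k j _.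
by rewrite h // IH // => i hi; rewrite h // ltnW.
Qed.

Definition shift (x : nat -> int) (i : nat) (s : int) (j : nat) : int :=
  if j == i then x j + s else x j.

(** The recursion on the dimension satisfies the one-step recursion in time that
    characterizes the walk. *)
Lemma srwS d x m : srw d x m.+1 =
  \sum_(i < d) (srw d (shift x i (-1)) m + srw d (shift x i 1) m) / 2.
Proof.
elim: d m => [|d IH] m /=; first by rewrite big_ord0.
rewrite binsumS big_ord_recr /= binsumD; congr (_ + _).
  under eq_bigr => i _ do rewrite -binsumD mulrC -binsumZ.
  rewrite /binsum exchange_big /=; apply: eq_bigr => k _.
  rewrite IH mulrA mulr_sumr; apply: eq_bigr => i _.
  rewrite /shift gtn_eqF //; ring.
rewrite -binsumD mulrC -binsumZ; apply: eq_binsum => k j _.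
rewrite /shift eqxx !(@eq_srw d _ x); first ring.
  by move=> i hi; rewrite ltn_eqF.
by move=> i hi; rewrite ltn_eqF.
Qed.

(** Cauchy-Schwarz for the weights 'C(m, k) w k j, with hypotheses on squares so
    that no square root or division is needed. *)
Lemma binsum_Cauchy_Schwarz m (F w v : nat -> nat -> R) :
  (forall k j, (k + j)%N = m ->
    [/\ 0 <= w k j, 0 <= v k j & F k j ^+ 2 <= w k j ^+ 2 * v k j]) ->
  binsum m F ^+ 2 <= binsum m w * binsum m (fun k j => w k j * v k j).
Proof.
move=> h.
have hk (k : 'I_m.+1) : (k + (m - k))%N = m by rewrite subnKC // -ltnS.
set c : 'I_m.+1 -> R := fun k => 'C(m, k)%:R.
set f : 'I_m.+1 -> R := fun k => F k (m - k)%N.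
set g : 'I_m.+1 -> R := fun k => w k (m - k)%N.
set u : 'I_m.+1 -> R := fun k => v k (m - k)%N.
have e2 : binsum m w * binsum m (fun k j => w k j * v k j) =
    \sum_k \sum_l (c k * c l) * (g k * g l * ((u k + u l) / 2)).
  have -> : binsum m w * binsum m (fun k j => w k j * v k j) =
      \sum_k \sum_l (c k * g k) * (c l * (g l * u l)).
    by rewrite /binsum mulr_suml; apply: eq_bigr => k _; rewrite mulr_sumr.
  set S := LHS; have S2 : S = (S + S) / 2 by field.
  rewrite S2 {1}/S exchange_big /S -big_split /= mulr_suml.
  apply: eq_bigr => k _; rewrite -big_split mulr_suml; apply: eq_bigr => l _ /=.
  by field.
rewrite e2 expr2 {1 2}/binsum mulr_suml; apply: ler_sum => k _.
rewrite mulr_sumr; apply: ler_sum => l _.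
have [gk uk fk] := h _ _ (hk k); have [gl ul fl] := h _ _ (hk l).
rewrite mulrACA ler_wpM2l ?mulr_ge0 //.
apply: le_trans (ler_norm _) _.
rewrite -ler_sqr ?nnegrE ?mulr_ge0 ?addr_ge0 ?invr_ge0 //.
rewrite real_normK ?num_real // [leLHS]exprMn.
apply: le_trans (ler_pM (sqr_ge0 _) (sqr_ge0 _) fk fl) _.
rewrite mulrACA -exprMn [leRHS]exprMn ler_wpM2l ?sqr_ge0 //.
have := sqr_ge0 (u k - u l); rewrite /u; nra.
Qed.

(** A factor (j+1)^(-d) in a sum of binomials over row m can be traded for d!
    (m+1)^(-d) by moving to row m + d. *)
Lemma bin_poly_le (m d k : nat) : (k <= m)%N ->
  ('C(m, k) * m.+1 ^ d <= d`! * 'C(m + d, k) * (m - k).+1 ^ d)%N.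
Proof.
move=> km; elim: d => [|d IH]; first by rewrite !expn0 !muln1 fact0 mul1n addn0.
rewrite !expnS factS.
have h := mul_bin_down (m + d).+1 k; rewrite /= in h.
have e : ((m + d).+1 - k = (m - k) + d.+1)%N by lia.
rewrite {}e in h; rewrite addnS.
have h2 : ((m - k) + d.+1 <= d.+1 * (m - k).+1)%N by nia.
move: (m.+1 ^ d)%N ((m - k).+1 ^ d)%N IH h h2 => p q IH h h2.
apply: (@leq_trans (m.+1 * (d`! * 'C(m + d, k) * q))).
  by rewrite mulnCA leq_mul2l IH orbT.
apply: (@leq_trans ((m + d).+1 * (d`! * 'C(m + d, k) * q))).
  by rewrite leq_mul2r; apply/orP; right; lia.
have -> : ((m + d).+1 * (d`! * 'C(m + d, k) * q) = d`! * q * ((m - k + d.+1) * 'C((m + d).+1, k)))%N.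
  by rewrite -h; ring.
apply: (@leq_trans (d`! * q * (d.+1 * (m - k).+1 * 'C((m + d).+1, k)))).
  by rewrite !leq_mul2l !leq_mul2r h2 !orbT.
by apply: eq_leq; ring.
Qed.

(** This is where the decay m^(-d/2) of the heat kernel comes from: if one part
    of a random splitting decays like (k+1)^(-1) and the other like (j+1)^(-d),
    on average one gets (m+1)^(-(d+1)). *)
Lemma binsum_inv_le (m d : nat) :
  binsum m (fun k j => d%:R ^+ j * (k.+1%:R * j.+1%:R ^+ d)^-1) * m.+1%:R ^+ d.+1
  <= d`!%:R * d.+1%:R ^+ (m + d.+1) :> R.
Proof.
have -> : d.+1%:R ^+ (m + d.+1) =
    binsum (m + d.+1) (fun k j => 1 ^+ k * d%:R ^+ j) :> R.
  by rewrite binsum_exp -natr1 addrC.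
rewrite /binsum; have -> : (m + d.+1).+1 = (m.+2 + d)%N by lia.
rewrite [in leRHS]big_split_ord /= mulrDr.
apply: ler_wpDr.
  rewrite mulr_ge0 //; apply: sumr_ge0 => i _.
  by apply: mulr_ge0 => //; apply: mulr_ge0; exact: exprn_ge0.
rewrite [in leRHS]big_ord_recl mulrDr; apply: ler_wpDl.
  by do 2?apply: mulr_ge0 => //; apply: mulr_ge0; exact: exprn_ge0.
rewrite mulr_suml mulr_sumr; apply: ler_sum => k _.
have km : (k <= m)%N by rewrite -ltnS.
rewrite /= /bump /= add1n expr1n mul1r.
have -> : (m + d.+1 - k.+1 = (m - k) + d)%N by lia.
set j := (m - k)%N.
have h : ('C(m, k) * m.+1 ^ d.+1 <= d`! * 'C(m + d.+1, k.+1) * (k.+1 * j.+1 ^ d))%N.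
  have h1 := bin_poly_le d km.
  have h2 := mul_bin_diag (m + d).+1 k; rewrite /= in h2.
  have -> : (d`! * 'C(m + d.+1, k.+1) * (k.+1 * j.+1 ^ d) = (m + d).+1 * (d`! * 'C(m + d, k) * j.+1 ^ d))%N.
    rewrite addnS [RHS]mulnCA -mulnA [in RHS]mulnA.
    by transitivity (d`! * ((k.+1 * 'C((m + d).+1, k.+1)) * j.+1 ^ d))%N;
       [ring | rewrite -h2; ring].
  by rewrite expnS mulnCA leq_mul // ltnS leq_addr.
rewrite -(ler_nat R) !natrM !natrX in h.
have p0 : 0 < k.+1%:R * j.+1%:R ^+ d :> R by rewrite mulr_gt0 ?exprn_gt0.
have dj : d%:R ^+ j <= d%:R ^+ (j + d) :> R.
  case: (d) => [|e]; first by rewrite addn0.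
  by rewrite ler_weXn2l ?ler1n // leq_addr.
have e4 (a b c e : R) : a * (b * c) * e = a * e * b * c by ring.
rewrite e4 ler_pdivrMr //.
apply: le_trans (ler_pM _ _ h dj) _; rewrite ?mulr_ge0 ?exprn_ge0 //.
by rewrite le_eqVlt; apply/orP; left; apply/eqP; ring.
Qed.


(** Any bounds D i on the squared one-dimensional kernels, normalized by k+1,
    multiply in dimension d. The bounds only have to hold up to time m and may
    depend on m; this lets one coordinate carry a decay in space. *)
Lemma srw_upper d : exists2 C : R, 0 < C & forall x m (D : nat -> R),
  (forall i, 0 <= D i) ->
  (forall i k, (i < d)%N -> (k <= m)%N -> srw1 R k (x i) ^+ 2 * k.+1%:R <= D i) ->
  srw d x m ^+ 2 * m.+1%:R ^+ d <= C * (\prod_(i < d) D i) * (d%:R ^+ m) ^+ 2.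
Proof.
elim: d => [|d [C C0 IH]].
  exists 1 => // x m D _ _ /=; rewrite big_ord0 !mul1r expr0 mulr1 expr0n.
  by case: m.
exists (C * d`!%:R * d.+1%:R ^+ d.+1).
  by rewrite !mulr_gt0 ?exprn_gt0 // ltr0n fact_gt0.
move=> x m D D0 hD.
set Pi := \prod_(i < d) D i.
have Pi0 : 0 <= Pi by apply: prodr_ge0.
have h k j : (k + j)%N = m -> [/\ 0 <= d%:R ^+ j :> R,
    0 <= C * Pi * D d * (k.+1%:R * j.+1%:R ^+ d)^-1 &
    (srw1 R k (x d) * srw d x j) ^+ 2 <=
      (d%:R ^+ j) ^+ 2 * (C * Pi * D d * (k.+1%:R * j.+1%:R ^+ d)^-1)].
  move=> kj; have p0 : 0 < k.+1%:R * j.+1%:R ^+ d :> R by rewrite mulr_gt0 ?exprn_gt0.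
  split; first exact: exprn_ge0.
    by rewrite mulr_ge0 ?invr_ge0 ?(ltW p0) // mulr_ge0 // mulr_ge0 // ltW.
  rewrite mulrA ler_pdivlMr // exprMn.
  have h1 := IH x j D D0; have h2 := hD d k (ltnSn d).
  have {}h1 : srw d x j ^+ 2 * j.+1%:R ^+ d <= C * Pi * (d%:R ^+ j) ^+ 2.
    by apply: h1 => i l id lj; apply: hD; lia.
  have {}h2 : srw1 R k (x d) ^+ 2 * k.+1%:R <= D d by apply: h2; lia.
  rewrite mulrACA; apply: le_trans (ler_pM _ _ h2 h1) _.
  - by apply: mulr_ge0 => //; exact: sqr_ge0.
  - by apply: mulr_ge0; [exact: sqr_ge0|exact: exprn_ge0].
  by rewrite le_eqVlt; apply/orP; left; apply/eqP; ring.
have := binsum_Cauchy_Schwarz h; rewrite -/(srw d.+1 x m) => hCS.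
have m0 : 0 < m.+1%:R ^+ d.+1 :> R by rewrite exprn_gt0.
apply: le_trans (ler_wpM2r (ltW m0) hCS) _.
rewrite big_ord_recr /= -/Pi.
have -> : binsum m (fun _ j => d%:R ^+ j) = d.+1%:R ^+ m :> R.
  rewrite -natr1 addrC -binsum_exp; apply: eq_binsum => k j _.
  by rewrite expr1n mul1r.
have -> : binsum m (fun k j => d%:R ^+ j * (C * Pi * D d * (k.+1%:R * j.+1%:R ^+ d)^-1))
   = C * Pi * D d * binsum m (fun k j => d%:R ^+ j * (k.+1%:R * j.+1%:R ^+ d)^-1).
  by rewrite -binsumZ; apply: eq_binsum => k j _; rewrite mulrCA.
have := binsum_inv_le m d; set S := binsum _ _ => hS.
have -> : d.+1%:R ^+ m * (C * Pi * D d * S) * m.+1%:R ^+ d.+1 =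
   (C * Pi * D d * d.+1%:R ^+ m) * (S * m.+1%:R ^+ d.+1) by ring.
apply: le_trans (ler_wpM2l _ hS) _.
  by rewrite mulr_ge0 ?exprn_ge0 // mulr_ge0 // mulr_ge0 // ltW.
by rewrite exprD le_eqVlt; apply/orP; left; apply/eqP; ring.
Qed.

Definition sqnorm (d : nat) (x : nat -> int) : R := \sum_(i < d) (x i)%:~R ^+ 2.

Lemma srw_dim1 x m : srw 1 x m = srw1 R m (x 0%N).
Proof.
rewrite /= /binsum big_ord_recr /= big1 ?add0r ?binn ?subnn ?eqxx ?mulr1 ?mul1r //.
move=> i _; rewrite (_ : (_ == _) = false) ?mulr0 //.
by apply/eqP; have := ltn_ord i; lia.
Qed.

(** The even and the odd binomial weights differ by (d-1)^m, which is at most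
    (d-1)/(d+1) of their sum. *)
Lemma parity_mass d m (y : nat) : (0 < d)%N -> (0 < m)%N ->
  d.+1%:R ^+ m / d.+1%:R <=
  binsum m (fun k j => d%:R ^+ j * ((1 + (-1) ^+ (k + y)) / 2)) :> R.
Proof.
move=> d0 m0.
have -> : binsum m (fun k j => d%:R ^+ j * ((1 + (-1) ^+ (k + y)) / 2)) =
    (d.+1%:R ^+ m + (-1) ^+ y * (d%:R - 1) ^+ m) / 2 :> R.
  transitivity (2^-1 * (binsum m (fun k j => 1 ^+ k * d%:R ^+ j) +
     (-1) ^+ y * binsum m (fun k j => (-1) ^+ k * d%:R ^+ j)) : R).
    rewrite -binsumZ -binsumD -binsumZ; apply: eq_binsum => k j _.
    by rewrite expr1n exprD; ring.
  by rewrite !binsum_exp [1 + _]addrC natr1 [-1 + _]addrC mulrC.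
have d1 : 0 <= d%:R - 1 :> R by rewrite subr_ge0 ler1n.
have h : (d%:R - 1) ^+ m <= d.+1%:R ^+ m * ((d%:R - 1) / d.+1%:R) :> R.
  rewrite mulrA ler_pdivlMr // -(prednK m0) exprS [_ ^+ m.-1.+1]exprS.
  rewrite mulrAC [leRHS]mulrC mulrA ler_wpM2l ?mulr_ge0 //.
  rewrite lerXn2r ?nnegrE // -natr1; lra.
have h2 : - (d%:R - 1) ^+ m <= (-1) ^+ y * (d%:R - 1) ^+ m :> R.
  have p0 : 0 <= (d%:R - 1) ^+ m :> R by exact: exprn_ge0.
  by rewrite -signr_odd; case: (odd y); rewrite ?expr1 ?expr0; lra.
have -> : d.+1%:R ^+ m / d.+1%:R = (d.+1%:R ^+ m - d.+1%:R ^+ m * ((d%:R - 1) / d.+1%:R)) / 2 :> R.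
  by move: (_ ^+ m) => z; rewrite -natr1; field; rewrite natr1 pnatr_eq0.
move: h h2; set a := (d%:R - 1) ^+ m; set b := _ * ((d%:R - 1) / _).
move: ((-1) ^+ y * a) => c h h2.
by rewrite ler_pM2r ?invr_gt0 // lerD2l; apply: le_trans h2; rewrite lerN2.
Qed.

(** Chebyshev: subtracting 4 (k(d+1) - m)^2 / m^2 makes the weight nonpositive
    unless k is comparable to m and of the right parity, and the variance shows
    that for large m the subtraction costs at most half of the bound of
    parity_mass. *)
Lemma central_parity_mass d m (y : nat) : (0 < d)%N -> (8 * d * d.+1 <= m)%N -> (0 < m)%N ->
  d.+1%:R ^+ m / (2 * d.+1%:R) <=
  binsum m (fun k j => d%:R ^+ j * ((1 + (-1) ^+ (k + y)) / 2 -
     4 * (d.+1%:R * k%:R - m%:R) ^+ 2 / m%:R ^+ 2)) :> R.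
Proof.
move=> d0 hm m0.
have -> : binsum m (fun k j => d%:R ^+ j * ((1 + (-1) ^+ (k + y)) / 2 -
     4 * (d.+1%:R * k%:R - m%:R) ^+ 2 / m%:R ^+ 2)) =
   binsum m (fun k j => d%:R ^+ j * ((1 + (-1) ^+ (k + y)) / 2)) +
   (- (4 / m%:R ^+ 2)) * binsum m (fun k j => d%:R ^+ j * (d.+1%:R * k%:R - m%:R) ^+ 2) :> R.
  by rewrite -binsumZ -binsumD; apply: eq_binsum => k j _; ring.
have := parity_mass y d0 m0; rewrite binsum_var => h.
have mp : 0 < m%:R :> R by rewrite ltr0n.
have -> : - (4 / m%:R ^+ 2) * ((m * d)%:R * d.+1%:R ^+ m) = - (d.+1%:R ^+ m * (4 * d%:R / m%:R)) :> R.
  by rewrite natrM; field; rewrite gt_eqF.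
have h2 : 4 * d%:R / m%:R <= (2 * d.+1%:R)^-1 :> R.
  rewrite ler_pdivrMr // [leRHS]mulrC ler_pdivlMr ?mulr_gt0 //.
  rewrite -!natrM ler_nat; lia.
have h3 : d.+1%:R ^+ m * (4 * d%:R / m%:R) <= d.+1%:R ^+ m * (2 * d.+1%:R)^-1 :> R.
  by rewrite ler_wpM2l // exprn_ge0.
have e : d.+1%:R ^+ m / d.+1%:R = 2 * (d.+1%:R ^+ m / (2 * d.+1%:R)) :> R.
  by rewrite invfM; field; rewrite addrC natr1 pnatr_eq0.
rewrite e in h; move: h h3.
move: (_ / (2 * d.+1%:R)) (d.+1%:R ^+ m * (4 * _ / _)) (binsum _ _) => u v w; lra.
Qed.

(** Induction on d. Only the splittings singled out by central_parity_mass are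
    kept: both parts then have length comparable to m, so that the induction
    hypothesis and srw1_ge apply to them. *)
Lemma srw_lower d (B : R) : (0 < d)%N -> 0 <= B -> exists c M : R,
  0 < c /\ forall x m, M <= m%:R -> sqnorm d x <= B * m%:R ->
    (2 %| m%:Z - \sum_(i < d) x i)%Z ->
    c * d%:R ^+ m / Num.sqrt m.+1%:R ^+ d <= srw d x m.
Proof.
case: d => // d _; elim: d B => [|d IH] B B0.
  exists (expR (- B) / 2), (9 * B); split; first by rewrite divr_gt0 ?expR_gt0.
  move=> x m hm; rewrite /sqnorm !big_ord_recl !big_ord0 !addr0 => hB hp.
  by rewrite srw_dim1 expr1n mulr1 expr1; exact: srw1_ge hB hm hp.
have B4 : 0 <= 4 * B by rewrite mulr_ge0.
have [c1 [M1 [c10 hL]]] := IH _ B4.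
set D := d.+1 in hL *.
have n0 : 0 < D.+1%:R :> R by [].
pose B2 := 2 * D.+1%:R * B; have B20 : 0 <= B2 by rewrite !mulr_ge0.
pose c0 : R := expR (- B2) / 2; have c00 : 0 < c0 by rewrite divr_gt0 ?expR_gt0.
exists (c0 * c1 / (2 * D.+1%:R)).
exists ((8 * D * D.+1)%:R + 4 * `|M1| + 36 * D.+1%:R ^+ 2 * B + 1).
split; first by apply: divr_gt0; apply: mulr_gt0.
move=> x m hm hB hp.
have p1 : 0 <= (8 * D * D.+1)%:R :> R by [].
have p2 : 0 <= `|M1| by [].
have p3 : 0 <= 36 * D.+1%:R ^+ 2 * B by rewrite mulr_ge0 // mulr_ge0 // exprn_ge0.
have m1 : 1 <= m%:R :> R by lra.
have hm1 : (8 * D * D.+1 <= m)%N by rewrite -(ler_nat R); lra.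
have hm2 : 4 * M1 <= m%:R by have := ler_norm M1; lra.
have hm3 : 36 * D.+1%:R ^+ 2 * B <= m%:R by lra.
have m0 : (0 < m)%N by rewrite -(ler_nat R).
clear hm p1 p2 p3.
pose s := Num.sqrt m.+1%:R : R; have s0 : 0 < s by rewrite sqrtr_gt0.
pose K := c0 * c1 / s ^+ D.+1.
have K0 : 0 <= K by apply: divr_ge0; [apply: mulr_ge0; exact: ltW|exact/exprn_ge0/ltW].
rewrite /sqnorm big_ord_recr /= -/(sqnorm D x) in hB.
rewrite big_ord_recr /= in hp.
set y := x D in hB hp.
have nsq0 : 0 <= sqnorm D x by apply: sumr_ge0 => i _; exact: sqr_ge0.
have := central_parity_mass `|y| (ltn0Sn d) hm1 m0; rewrite -/D => /(ler_wpM2l K0).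
have -> : K * (D.+1%:R ^+ m / (2 * D.+1%:R)) =
   c0 * c1 / (2 * D.+1%:R) * D.+1%:R ^+ m / s ^+ D.+1.
  by rewrite /K; ring.
move/le_trans; apply; rewrite -binsumZ; apply: ler_binsum => k j kj.
(* Unless k is central and of the parity of y, the weight b is nonpositive and
   there is nothing to prove. *)
set v := (D.+1%:R * k%:R - m%:R) ^+ 2.
set b := (X in _ * (_ * X)).
have Dj0 : 0 <= D%:R ^+ j :> R by exact: exprn_ge0.
have lhs0 : b <= 0 -> K * (D%:R ^+ j * b) <= srw1 R k y * srw D x j.
  move=> b0; apply: (@le_trans _ _ 0); last by rewrite mulr_ge0 ?srw1_ge0 ?srw_ge0.
  by rewrite mulr_ge0_le0 // mulr_ge0_le0.
have msq0 : 0 < m%:R ^+ 2 :> R by rewrite exprn_gt0 // ltr0n.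
have v0 : 0 <= v by exact: sqr_ge0.
have vm0 : 0 <= 4 * v / m%:R ^+ 2 by apply: divr_ge0; [exact: mulr_ge0|exact: ltW].
have [/dvdzP[q hq]|podd] := boolP (2 %| k%:Z - y)%Z; last first.
  apply: lhs0; rewrite /b -signr_odd (_ : odd _ = true) ?expr1 ?subrr; first lra.
  apply: contraNT podd => ev; apply/dvdzP.
  have [q hq] : exists q, (k + `|y| = q.*2)%N.
    by exists (k + `|y|)./2; rewrite even_halfK.
  clear -hq; have [y0|y0] := ger0P y; first by exists (q%:Z - y); lia.
  by exists q%:Z; lia.
have [hfar|hnear] := lerP (m%:R ^+ 2) (4 * v).
  apply: lhs0; have : 1 <= 4 * v / m%:R ^+ 2 by rewrite ler_pdivlMr ?mul1r.
  by rewrite /b -signr_odd; case: (odd _); rewrite ?expr1 ?expr0; lra.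
have b1 : b <= 1 by rewrite /b -signr_odd; case: (odd _); rewrite ?expr1 ?expr0; lra.
have mkj : m%:R = k%:R + j%:R :> R by rewrite -kj natrD.
have eD : D.+1%:R = 1 + D%:R :> R by rewrite -natr1 addrC.
have D1 : 1 <= D%:R :> R by rewrite ler1n.
have [hk1 hk2] : m%:R < 2 * D.+1%:R * k%:R :> R /\ 2 * D.+1%:R * k%:R < 3 * m%:R :> R.
  have : `|2 * (D.+1%:R * k%:R - m%:R)| < m%:R :> R.
    by rewrite -ltr_sqr ?nnegrE // real_normK ?num_real // exprMn -natrX.
  by rewrite ltr_norml => /andP[]; split; lra.
have k0 : 0 <= k%:R :> R by [].
have j0 : 0 <= j%:R :> R by [].
have hj : m%:R <= 4 * j%:R :> R.
  have : 0 <= (D%:R - 1) * k%:R :> R by rewrite mulr_ge0 // subr_ge0.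
  by move=> ?; rewrite eD in hk2; lra.
have q1 : c0 / Num.sqrt k.+1%:R <= srw1 R k y.
  apply: srw1_ge => //.
  - have h1 : B * m%:R <= B * (2 * D.+1%:R * k%:R) by apply: ler_wpM2l => //; exact: ltW.
    rewrite /B2 (_ : 2 * _ * B * k%:R = B * (2 * D.+1%:R * k%:R)); last ring.
    by lra.
  - rewrite /B2 -(ler_pM2l (_ : 0 < 2 * D.+1%:R)) ?mulr_gt0 //.
    by apply: le_trans (ltW hk1); apply: le_trans hm3; rewrite le_eqVlt; apply/orP; left; apply/eqP; ring.
  by rewrite hq dvdz_mull.
have q2 : c1 * D%:R ^+ j / Num.sqrt j.+1%:R ^+ D <= srw D x j.
  apply: hL; first lra.
  - have : B * m%:R <= B * (4 * j%:R) by rewrite ler_wpM2l.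
    by have := sqr_ge0 (y%:~R : R); lra.
  case/dvdzP: hp => r hr; apply/dvdzP; exists (r - q).
  move: (\sum_(i < D) x i) hr => S hr; clear -hq hr kj.
  by lia.
apply: le_trans (ler_pM _ _ q1 q2); last 2 first.
- by apply: divr_ge0; [exact: ltW|exact: sqrtr_ge0].
- by apply: divr_ge0; [apply: mulr_ge0 => //; exact: ltW|exact/exprn_ge0/sqrtr_ge0].
have ks : Num.sqrt k.+1%:R <= s by rewrite ler_sqrt // ler_nat ltnS -kj leq_addr.
have js : Num.sqrt j.+1%:R <= s by rewrite ler_sqrt // ler_nat ltnS -kj leq_addl.
have k1 : 0 < Num.sqrt k.+1%:R :> R by rewrite sqrtr_gt0.
have j1 : 0 < Num.sqrt j.+1%:R :> R by rewrite sqrtr_gt0.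
apply: (@le_trans _ _ (K * (D%:R ^+ j * 1))).
  by rewrite ler_wpM2l // ler_wpM2l.
have -> : K * (D%:R ^+ j * 1) = (c0 / s) * (c1 * D%:R ^+ j / s ^+ D).
  by rewrite /K exprS invfM; ring.
apply: ler_pM.
- by apply: divr_ge0; exact: ltW.
- by apply: divr_ge0; [apply: mulr_ge0 => //; exact: ltW|exact/exprn_ge0/ltW].
- by rewrite ler_wpM2l ?(ltW c00) // lef_pV2.
rewrite ler_wpM2l ?mulr_ge0 ?(ltW c10) // lef_pV2 ?posrE ?exprn_gt0 //.
by rewrite lerXn2r ?nnegrE // ltW.
Qed.
End Walk.

Section Heat.
Variable R : realType.

Lemma le_sqrt_bound (d : nat) (p K t : R) : 0 <= p -> 0 <= K -> 0 < t ->
  p ^+ 2 * t ^+ d <= K -> p <= Num.sqrt K / Num.sqrt t ^+ d.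
Proof.
move=> p0 K0 t0 h; have st : 0 < Num.sqrt t ^+ d by rewrite exprn_gt0 ?sqrtr_gt0.
rewrite ler_pdivlMr // -ler_sqr ?nnegrE ?sqrtr_ge0 ?mulr_ge0 ?(ltW st) //.
by rewrite sqr_sqrtr // exprMn exprAC sqr_sqrtr ?(ltW t0).
Qed.

Lemma srw_le_time d : (0 < d)%N -> exists2 C : R, 0 < C & forall x m,
  srw R d x m / d%:R ^+ m <= C / Num.sqrt m.+1%:R ^+ d.
Proof.
move=> d0; have [C C0 h] := srw_upper R d.
have dm m : 0 < d%:R ^+ m :> R by rewrite exprn_gt0 // ltr0n.
exists (Num.sqrt C); first by rewrite sqrtr_gt0.
move=> x m; apply: le_sqrt_bound; rewrite ?(ltW C0) //.
  by apply: divr_ge0; [exact: srw_ge0|exact: ltW].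
have := h x m (fun=> 1) (fun=> ler01) (fun i k _ _ => srw1_le_time R k (x i)).
rewrite big1 // mulr1 => h1.
by rewrite expr_div_n mulrAC ler_pdivrMr; [exact: h1|exact: exprn_gt0].
Qed.

Lemma sqnorm_le_coord d x : (0 < d)%N ->
  exists2 i, (i < d)%N & sqnorm R d x <= d%:R * (x i)%:~R ^+ 2.
Proof.
case: d => // d _; apply: contrapT => hno.
have h (i : 'I_d.+1) : (x i)%:~R ^+ 2 < sqnorm R d.+1 x / d.+1%:R.
  rewrite ltNge; apply/negP => hi; apply: hno; exists i => //.
  by move: hi; rewrite ler_pdivrMr // mulrC.
have : sqnorm R d.+1 x < \sum_(i < d.+1) (sqnorm R d.+1 x / d.+1%:R).
  apply: ltr_sum => //; exact: (introT hasP (ex_intro2 _ _ ord0 (mem_index_enum _) isT)).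
by rewrite sumr_const card_ord -[_ / _ *+ _]mulr_natr divfK ?pnatr_eq0 // ltxx.
Qed.

(** Some coordinate of x has square at least |x|^2/d; srw_upper is used with the
    time decay on the other axes and the bound srw1_le_poly, of the exponent
    matching d, on this one. *)
Lemma srw_le_space d : (0 < d)%N -> exists2 C : R, 0 < C & forall x m,
  0 < sqnorm R d x ->
  srw R d x m / d%:R ^+ m <= C / Num.sqrt (sqnorm R d x) ^+ d.
Proof.
move=> d0; have [C C0 h] := srw_upper R d.
have dm m : 0 < d%:R ^+ m :> R by rewrite exprn_gt0 // ltr0n.
pose Ke : R := expR (1 / 2) * d`!%:R * 2 ^+ d.
have Ke0 : 0 < Ke.
  by rewrite mulr_gt0 ?exprn_gt0 // mulr_gt0 ?expR_gt0 // ltr0n fact_gt0.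
have CK0 : 0 < C * Ke * d%:R ^+ d by rewrite mulr_gt0 // mulr_gt0.
exists (Num.sqrt (C * Ke * d%:R ^+ d)); first by rewrite sqrtr_gt0.
move=> x m N0; apply: le_sqrt_bound; rewrite ?(ltW CK0) //.
  by apply: divr_ge0; [exact: srw_ge0|exact: ltW].
have [i id hi] := sqnorm_le_coord x d0.
set Y := (x i)%:~R ^+ 2 in hi.
have Y0 : 0 < Y by rewrite -(pmulr_rgt0 _ (_ : 0 < d%:R)) ?ltr0n //; exact: lt_le_trans hi.
have Yd : 0 < Y ^+ d by rewrite exprn_gt0.
(* The exponent d of Y makes the powers of m cancel in the end. *)
pose D j := if j == i then Ke * m.+1%:R ^+ d / Y ^+ d else 1.
have D0 j : 0 <= D j.
  rewrite /D; case: ifP => // _; apply: divr_ge0; last exact: ltW.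
  by apply: mulr_ge0; [exact: ltW|exact: exprn_ge0].
have hD j k : (j < d)%N -> (k <= m)%N -> srw1 R k (x j) ^+ 2 * k.+1%:R <= D j.
  move=> jd km.
  rewrite /D; case: eqP => [->|_]; last exact: srw1_le_time.
  rewrite ler_pdivlMr //; case: d d0 {id h dm hi D D0 CK0 N0 jd} @Ke Ke0 Yd => // e _ Ke Ke0 Yd.
  apply: le_trans (srw1_le_poly _ _ _ _) _.
  by rewrite ler_wpM2l ?(ltW Ke0) // lerXn2r ?nnegrE // ler_nat.
have := h x m D D0 hD.
have -> : \prod_(j < d) D j = Ke * m.+1%:R ^+ d / Y ^+ d.
  rewrite (bigD1 (Ordinal id)) //= /D eqxx big1 ?mulr1 // => j.
  by rewrite -val_eqE /= => /negbTE ->.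
move=> h1.
have mm : 0 < m.+1%:R ^+ d :> R by rewrite exprn_gt0.
have h2 : (srw R d x m / d%:R ^+ m) ^+ 2 <= C * Ke / Y ^+ d.
  rewrite -(ler_pM2r mm) expr_div_n mulrAC ler_pdivrMr; last exact: exprn_gt0.
  apply: le_trans h1 _; rewrite le_eqVlt; apply/orP; left; apply/eqP; ring.
apply: (@le_trans _ _ (C * Ke / Y ^+ d * (d%:R * Y) ^+ d)).
  apply: ler_pM => //; first exact: sqr_ge0.
    by apply: exprn_ge0; exact: ltW.
  by rewrite lerXn2r ?nnegrE // ?(ltW N0) // mulr_ge0 // ltW.
rewrite [(d%:R * Y) ^+ d]exprMn le_eqVlt; apply/orP; left; apply/eqP.
by rewrite [_ * Y ^+ d]mulrC mulrA divfK ?gt_eqF.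
Qed.

End Heat.

(** * Renewal sequences *)

Section Renewal.
Variable R : realType.
Variable c : nat -> R.
Hypothesis c_ge0 : forall k, 0 <= c k.
Hypothesis c00 : c 0%N = 0.

(** The n-th convolution power of c, which is the law of T_n. *)
Fixpoint conv_pow (n m : nat) : R :=
  if n is n'.+1 then \sum_(0 <= k < m.+1) c k * conv_pow n' (m - k)
  else (m == 0)%:R.

(** The expected number of n such that T_n = m. The sum stops at m since every
    jump is at least 1. *)
Definition renewal (m : nat) : R := \sum_(0 <= n < m.+1) conv_pow n m.

Lemma conv_pow_ge0 n m : 0 <= conv_pow n m.
Proof.
elim: n m => [|n IH] m /=; first by [].
by apply: sumr_ge0 => k _; rewrite mulr_ge0.
Qed.

Lemma conv_pow_small n m : (m < n)%N -> conv_pow n m = 0.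
Proof.
elim: n m => [//|n IH] m mn /=.
rewrite big_nat big1 // => -[|k] /andP[_ km]; first by rewrite c00 mul0r.
by rewrite IH ?mulr0 //; lia.
Qed.

Lemma sum_conv_pow N m : (m < N)%N ->
  \sum_(0 <= n < N) conv_pow n m = renewal m.
Proof.
move=> mN; rewrite /renewal (big_cat_nat (leq0n m.+1) mN) /=.
rewrite [X in _ + X]big_nat [X in _ + X]big1 ?addr0 // => k /andP[km _].
by rewrite conv_pow_small.
Qed.

Lemma renewal_ge0 m : 0 <= renewal m.
Proof. by apply: sumr_ge0 => n _; exact: conv_pow_ge0. Qed.

Lemma renewal0 : renewal 0 = 1.
Proof. by rewrite /renewal big_nat1. Qed.

Lemma renewalS m :
  renewal m.+1 = \sum_(0 <= k < m.+2) c k * renewal (m.+1 - k).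
Proof.
rewrite /renewal big_nat_recl //= add0r exchange_big /= big_nat [RHS]big_nat.
apply: eq_bigr => -[|k] /andP[_ km].
  by rewrite c00 mul0r big1 // => i _; rewrite mul0r.
rewrite -mulr_sumr; congr (_ * _); apply: sum_conv_pow; lia.
Qed.

(** Jumping by 1 right after visiting m. *)
Lemma renewal_step m : c 1%N * renewal m <= renewal m.+1.
Proof.
rewrite renewalS 2?big_nat_recl // c00 mul0r add0r subSS subn0 lerDl.
by apply: sumr_ge0 => k _; rewrite mulr_ge0 ?renewal_ge0.
Qed.

Definition gf (f : nat -> R) (s : R) (N : nat) := \sum_(0 <= m < N) f m * s ^+ m.

Lemma gf_ge0 f s N : (forall m, 0 <= f m) -> 0 <= s -> 0 <= gf f s N.
Proof. by move=> f0 s0; apply: sumr_ge0 => m _; rewrite mulr_ge0 ?exprn_ge0. Qed.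

Lemma gf_mono f s : (forall m, 0 <= f m) -> 0 <= s ->
  {homo gf f s : N M / (N <= M)%N >-> N <= M}.
Proof.
move=> f0 s0 N M NM; rewrite /gf (big_cat_nat (leq0n N) NM) /= lerDl.
by apply: sumr_ge0 => m _; rewrite mulr_ge0 ?exprn_ge0.
Qed.


(** For nonnegative terms, the triangle of indices lies between two squares;
    this turns the convolution equation of u into the two inequalities below. *)
Lemma sum_triangle (t : nat -> nat -> R) N :
  \sum_(0 <= m < N) \sum_(0 <= k < m.+1) t k (m - k)%N =
  \sum_(0 <= k < N) \sum_(0 <= j < N - k) t k j.
Proof.
elim: N => [|N IH]; first by rewrite !big_nil.
rewrite big_nat_recr //= IH [in RHS]big_nat.
under [RHS]eq_bigr => k /andP[_ kN] do rewrite subSn // big_nat_recr //=.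
rewrite -big_nat big_split /=; congr (_ + _).
by rewrite [RHS]big_nat_recr //= subnn big_nil addr0.
Qed.

Lemma renewalE m :
  renewal m = (m == 0)%:R + \sum_(0 <= k < m.+1) c k * renewal (m - k).
Proof.
by case: m => [|m]; [rewrite renewal0 big_nat1 c00 mul0r addr0|rewrite renewalS add0r].
Qed.

Lemma gf_renewalE s N : gf renewal s N.+1 = 1 +
  \sum_(0 <= k < N.+1) \sum_(0 <= j < N.+1 - k) (c k * s ^+ k) * (renewal j * s ^+ j).
Proof.
rewrite -sum_triangle /gf.
have -> : 1 = \sum_(0 <= m < N.+1) (m == 0%N)%:R :> R.
  by rewrite big_nat_recl // big1 ?addr0.
rewrite -big_split /=; apply: eq_big_nat => m _.
rewrite [in LHS]renewalE mulrDl; congr (_ + _).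
  by case: m => [|m]; rewrite ?mul0r // mul1r expr0.
rewrite mulr_suml; apply: eq_big_nat => k /andP[_ km].
by rewrite mulrACA -exprD subnKC.
Qed.

Let t0 s k j : 0 <= s -> 0 <= (c k * s ^+ k) * (renewal j * s ^+ j).
Proof.
by move=> s0; apply: mulr_ge0; apply: mulr_ge0; rewrite ?exprn_ge0 ?renewal_ge0.
Qed.

Let gf_mulE s N M : gf c s N * gf renewal s M =
  \sum_(0 <= k < N) \sum_(0 <= j < M) (c k * s ^+ k) * (renewal j * s ^+ j).
Proof. by rewrite /gf mulr_suml; apply: eq_bigr => k _; rewrite mulr_sumr. Qed.

Lemma ler_sum_widen (f : nat -> R) N M : (forall k, 0 <= f k) -> (N <= M)%N ->
  \sum_(0 <= k < N) f k <= \sum_(0 <= k < M) f k.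
Proof.
by move=> f0 NM; rewrite (big_cat_nat (leq0n N) NM) /= lerDl; exact: sumr_ge0.
Qed.

Lemma gf_renewal_le s N : 0 <= s ->
  gf renewal s N.+1 <= 1 + gf c s N.+1 * gf renewal s N.+1.
Proof.
move=> s0; rewrite {1}gf_renewalE lerD2l gf_mulE; apply: ler_sum => k _.
by apply: ler_sum_widen; [move=> j; exact: t0|exact: leq_subr].
Qed.

Lemma gf_renewal_ge s N : 0 <= s ->
  1 + gf c s N * gf renewal s N <= gf renewal s (N + N).+1.
Proof.
move=> s0; rewrite gf_renewalE lerD2l gf_mulE.
apply: (@le_trans _ _ (\sum_(0 <= k < N) \sum_(0 <= j < (N + N).+1 - k)
    (c k * s ^+ k) * (renewal j * s ^+ j))).
  rewrite big_nat [leRHS]big_nat; apply: ler_sum => k /andP[_ kN].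
  by apply: ler_sum_widen; [move=> j; exact: t0|lia].
apply: ler_sum_widen; last lia.
by move=> k; apply: sumr_ge0 => j _; exact: t0.
Qed.

Variable phi : R -> R.
Hypothesis phi_gt0 : forall r : R, 0 < r -> r <= 1 -> 0 < phi r.
Hypothesis phi_mono : forall r s : R, 0 < r -> r <= s -> s <= 1 -> phi r <= phi s.
Hypothesis phi_conc : forall t r : R, 0 < t -> t <= 1 -> 0 < r -> r <= 1 ->
  t * phi r <= phi (t * r).
Hypothesis c_gf : forall s : R, 0 <= s -> s < 1 ->
  gf c s N @[N --> \oo] --> 1 - phi (1 - s).

Lemma gf_renewal_bound s N : 0 <= s -> s < 1 -> gf renewal s N <= (phi (1 - s))^-1.
Proof.
move=> s0 s1.
have p0 : 0 < phi (1 - s) by apply: phi_gt0; lra.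
apply: (@le_trans _ _ (gf renewal s N.+1)).
  by apply: gf_mono => //; exact: renewal_ge0.
rewrite -[leRHS]div1r ler_pdivlMr //.
have h := gf_renewal_le N s0.
have hF : gf c s N.+1 <= 1 - phi (1 - s).
  have cv := c_gf s0 s1.
  rewrite -(cvg_lim _ cv) //; apply: nondecreasing_cvgn_le; last exact: cvgP cv.
  by move=> n m nm; exact: gf_mono.
have U0 := gf_ge0 N.+1 renewal_ge0 s0.
have : gf c s N.+1 * gf renewal s N.+1 <= (1 - phi (1 - s)) * gf renewal s N.+1.
  by rewrite ler_wpM2r.
lra.
Qed.

(** The limit U satisfies both U <= 1 + F U and U >= 1 + F U with F = 1 - phi(1
    - s). *)
Lemma gf_renewal_cvg s : 0 <= s -> s < 1 ->
  gf renewal s N @[N --> \oo] --> (phi (1 - s))^-1.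
Proof.
move=> s0 s1.
have p0 : 0 < phi (1 - s) by apply: phi_gt0; lra.
have ndU : nondecreasing_seq (gf renewal s).
  by move=> n m nm; apply: gf_mono => //; exact: renewal_ge0.
have cvU : cvgn (gf renewal s).
  apply: nondecreasing_is_cvgn => //.
  by exists (phi (1 - s))^-1 => _ [N _ <-]; exact: gf_renewal_bound.
suff -> : (phi (1 - s))^-1 = limn (gf renewal s) by exact: cvU.
apply/eqP; rewrite eq_le; apply/andP; split; last first.
  by apply: limr_le => //; near=> N; exact: gf_renewal_bound.
have h : 1 + (1 - phi (1 - s)) * limn (gf renewal s) <= limn (gf renewal s).
  have cv : (1 + gf c s N * gf renewal s N) @[N --> \oo] -->
      1 + (1 - phi (1 - s)) * limn (gf renewal s).
    by apply: cvgD; [exact: cvg_cst|apply: cvgM => //; exact: c_gf].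
  rewrite -[leLHS](cvg_lim _ cv) //; apply: limr_le; first exact: cvgP cv.
  near=> N; apply: le_trans (gf_renewal_ge N s0) _.
  exact: nondecreasing_cvgn_le.
rewrite -[leLHS]div1r ler_pdivrMr //; lra.
Unshelve. all: by end_near. Qed.

Lemma bernoulli_ineq (x : R) m : 0 <= x -> x <= 1 -> 1 - m%:R * x <= (1 - x) ^+ m.
Proof.
move=> x0 x1; elim: m => [|m IH]; first by rewrite mul0r subr0 expr0.
have m0 : 0 <= m%:R :> R by [].
have := ler_wpM2l (_ : 0 <= 1 - x) IH; rewrite subr_ge0 => /(_ x1).
rewrite exprS -natr1; nra.
Qed.

Lemma bernoulli_pos (x : R) m : 0 <= x -> 1 + m%:R * x <= (1 + x) ^+ m.
Proof.
move=> x0; elim: m => [|m IH]; first by rewrite mul0r addr0 expr0.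
have m0 : 0 <= m%:R :> R by [].
have := ler_wpM2l (_ : 0 <= 1 + x) IH; rewrite addr_ge0 // => /(_ isT).
rewrite exprS -natr1; nra.
Qed.

(** At s = 1 - 1/(2N) the weights s^m with m <= N are at least 1/2; concavity
    replaces 1/(2N) by 1/N. *)
Lemma renewal_mass_le N : (0 < N)%N ->
  \sum_(0 <= m < N.+1) renewal m <= 4 / phi (N%:R^-1).
Proof.
move=> N0; have Np : 0 < N%:R :> R by rewrite ltr0n.
have N1 : 1 <= N%:R :> R by rewrite ler1n.
set x : R := 2^-1 * N%:R^-1.
have i0 : 0 < N%:R^-1 :> R by rewrite invr_gt0.
have i1 : N%:R^-1 <= 1 :> R by rewrite invf_le1.
have x0 : 0 < x by rewrite /x; lra.
have x1 : x <= 1 / 2 by rewrite /x; lra.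
have xN : N%:R * x = 1 / 2 by rewrite /x mulrCA mulfV ?gt_eqF // mulr1 div1r.
have h : \sum_(0 <= m < N.+1) renewal m <= 2 * gf renewal (1 - x) N.+1.
  rewrite /gf mulr_sumr big_nat [leRHS]big_nat; apply: ler_sum => m /andP[_ mN].
  rewrite mulrCA -[leLHS]mulr1 ler_wpM2l ?renewal_ge0 //.
  have := @bernoulli_ineq x m (ltW x0) ltac:(lra).
  have : m%:R * x <= N%:R * x by rewrite ler_wpM2r ?(ltW x0) // ler_nat.
  lra.
apply: (le_trans h).
have := @gf_renewal_bound (1 - x) N.+1 ltac:(lra) ltac:(lra).
have -> : 1 - (1 - x) = x by lra.
have := @phi_conc 2^-1 N%:R^-1 ltac:(lra) ltac:(lra) ltac:(lra) ltac:(lra).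
rewrite -/x => h1 h2.
have px : 0 < phi x by apply: phi_gt0; lra.
have pN : 0 < phi N%:R^-1 by apply: phi_gt0; lra.
have h3 : (phi x)^-1 <= 2 / phi N%:R^-1.
  by rewrite -[leLHS]div1r ler_pdivrMr // mulrAC ler_pdivlMr //; lra.
lra.
Qed.

(** With d = 1/(KN) and x = d/2, the generating function at 1 - d equals 1 / phi
    d. The hypothesis on K bounds the part m <= N by a quarter of it. Beyond
    14KN one has (1 - d)^m <= (1 - x)^m / 8, so that part is at most an eighth
    of the generating function at 1 - x, hence by concavity again a quarter. *)
Lemma renewal_mass_ge (K N : nat) : (0 < K)%N -> (0 < N)%N ->
  16 * phi ((K * N)%:R^-1) <= phi (N%:R^-1) ->
  (2 * phi (N%:R^-1))^-1 <= \sum_(N.+1 <= m < (14 * K * N).+1) renewal m.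
Proof.
move=> K0 N0 hK; set L := (14 * K * N)%N; set d : R := (K * N)%:R^-1.
have KN0 : (0 < K * N)%N by rewrite muln_gt0 K0.
have KNp : 0 < (K * N)%:R :> R by rewrite ltr0n.
have d0 : 0 < d by rewrite invr_gt0.
have d1 : d <= 1 by rewrite invf_le1 // ler1n.
have Np : 0 < N%:R :> R by rewrite ltr0n.
have i0 : 0 < N%:R^-1 :> R by rewrite invr_gt0.
have i1 : N%:R^-1 <= 1 :> R by rewrite invf_le1 // ler1n.
have pd : 0 < phi d by exact: phi_gt0.
have pN : 0 < phi N%:R^-1 by exact: phi_gt0.
set H := \sum_(N.+1 <= m < L.+1) _.
have NL : (N.+1 <= L.+1)%N by rewrite ltnS leq_pmull // muln_gt0.
set x := d / 2; have dx : d = 2 * x by rewrite /x; lra.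
have x0 : 0 < x by rewrite /x; lra.
have Lx : L%:R * x = 7.
  by rewrite /x /L -mulnA natrM mulrA -[_ * d]mulrA mulfV ?gt_eqF //; lra.
have s0 : 0 <= 1 - d by lra.
(* (1 - d)^m <= (1 - x)^(2m), and (1 - x)^m <= 1 / (1 + m x) <= 1/8 since L x =
   7. *)
have tail m : (L < m)%N -> (1 - d) ^+ m <= 8^-1 * (1 - x) ^+ m.
  move=> Lm; have h1 : (1 - d) ^+ m <= (1 - x) ^+ m * (1 - x) ^+ m.
    by rewrite -exprMn lerXn2r ?nnegrE //; nra.
  apply: (le_trans h1); rewrite ler_wpM2r ?exprn_ge0 //; first lra.
  have h2 : (1 - x) ^+ m * (1 + x) ^+ m <= 1.
    by rewrite -exprMn exprn_ile1 //; nra.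
  have h3 := bernoulli_pos m (ltW x0).
  have h4 : L%:R * x <= m%:R * x by rewrite ler_wpM2r ?(ltW x0) // ler_nat ltnW.
  have h5 : 0 <= (1 - x) ^+ m by rewrite exprn_ge0 //; lra.
  have h6 : (1 - x) ^+ m * 8 <= (1 - x) ^+ m * (1 + x) ^+ m by rewrite ler_wpM2l //; lra.
  by rewrite -[leRHS]div1r ler_pdivlMr //; lra.
have px : 0 < phi x by apply: phi_gt0; lra.
have hx : (phi x)^-1 <= 2 / phi d.
  have := @phi_conc 2^-1 d ltac:(lra) ltac:(lra) d0 d1.
  rewrite [_ * d]mulrC -/x => h.
  by rewrite -[leLHS]div1r ler_pdivrMr // mulrAC ler_pdivlMr //; lra.
have hV : \sum_(0 <= m < N.+1) renewal m <= 4^-1 / phi d.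
  apply: le_trans (renewal_mass_le N0) _.
  by rewrite ler_pdivrMr // mulrAC ler_pdivlMr //; lra.
have hU M : (L.+1 <= M)%N -> gf renewal (1 - d) M <= 4^-1 / phi d + H + 4^-1 / phi d.
  move=> LM; rewrite /gf (big_cat_nat (leq0n L.+1) LM) /=.
  rewrite (big_cat_nat (leq0n N.+1) NL) /=.
  have e1 m : (1 - d) ^+ m <= 1 by rewrite exprn_ile1 //; lra.
  have h1 P i j : \sum_(i <= m < j | P m) renewal m * (1 - d) ^+ m
      <= \sum_(i <= m < j | P m) renewal m.
    by apply: ler_sum => m _; rewrite ler_piMr ?renewal_ge0.
  apply: lerD; first apply: lerD.
  - exact: le_trans (h1 _ _ _) hV.
  - exact: h1.
  apply: (@le_trans _ _ (8^-1 * gf renewal (1 - x) M)).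
    apply: (@le_trans _ _ (8^-1 * \sum_(L.+1 <= m < M) renewal m * (1 - x) ^+ m)).
      rewrite mulr_sumr big_nat [leRHS]big_nat; apply: ler_sum => m /andP[Lm _].
      by rewrite mulrCA ler_wpM2l ?renewal_ge0 // tail.
    rewrite ler_wpM2l //.
    rewrite /gf (big_cat_nat (leq0n L.+1) LM) /= lerDr; apply: sumr_ge0 => m _.
    by rewrite mulr_ge0 ?renewal_ge0 // exprn_ge0 //; lra.
  have := @gf_renewal_bound (1 - x) M ltac:(lra) ltac:(lra).
  by rewrite subKr; lra.
have hlim : (phi d)^-1 <= 4^-1 / phi d + H + 4^-1 / phi d.
  have cv := @gf_renewal_cvg (1 - d) s0 ltac:(lra).
  rewrite subKr in cv; rewrite -[leLHS](cvg_lim _ cv) //.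
  apply: limr_le; first exact: cvgP cv.
  by exists L.+1 => // M /= LM; exact: hU.
have : (phi N%:R^-1)^-1 <= (phi d)^-1.
  rewrite lef_pV2 ?posrE //; apply: phi_mono => //.
  by rewrite /d lef_pV2 ?posrE // ler_nat leq_pmull.
rewrite invfM; lra.
Qed.

(** Each m of the wrong parity passes a share c_1 of its mass to m + 1. *)
Lemma renewal_parity N L b : c 1%N <= 1 -> (N <= L)%N ->
  c 1%N / 2 * \sum_(N <= m < L) renewal m <=
  \sum_(N <= m < L.+1 | odd m == b) renewal m.
Proof.
move=> c1 NL; rewrite (bigID (fun m => odd m == b)) /=.
set A := \sum_(_ <= m < L | odd m == b) _; set B := \sum_(_ <= m < L | _ != _) _.
set S := \sum_(_ <= m < L.+1 | _) _.
have A0 : 0 <= A by apply: sumr_ge0 => m _; exact: renewal_ge0.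
have hA : A <= S.
  rewrite /S big_mkcond big_nat_recr //= -big_mkcond lerDl; case: ifP => // _.
  exact: renewal_ge0.
have hB : c 1%N * B <= S.
  rewrite /S big_mkcond big_nat_recl // -[leLHS]add0r; apply: lerD.
    by case: ifP => // _; exact: renewal_ge0.
  rewrite /B [\sum_(_ <= i < L | _) _]big_mkcond mulr_sumr; apply: ler_sum => m _ /=.
  case: (odd m) b {A B S A0 hA} => -[] /=; rewrite ?mulr0 //; exact: renewal_step.
have := ler_piMl A0 c1; have := c_ge0 1; lra.
Qed.
End Renewal.

Section GreenSum.
Variable R : realType.
Variables (u p : nat -> R) (phi : R -> R).
Hypothesis p_ge0 : forall m, 0 <= p m.
Hypothesis u_ge0 : forall m, 0 <= u m.
Hypothesis phi_pos : forall N, (0 < N)%N -> 0 < phi (N%:R^-1).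
Hypothesis u_mass : forall N, (0 < N)%N ->
  \sum_(0 <= m < N.+1) u m <= 4 / phi (N%:R^-1).

(** The block between 2^k N and 2^(k+1) N contributes a constant times
    rho^(k+1): its kernel bound is sqrt 2 ^ (- k d) times that at N, and its
    mass is at most (rho sqrt 2 ^ d)^(k+1) times the bound 4 A / phi(1/N). A
    geometric series remains. *)
Lemma weighted_sum_le (d N : nat) (C A rho : R) :
  (0 < N)%N -> 0 <= C -> 0 <= A -> 0 < rho -> rho < 1 ->
  (forall j, phi (N%:R^-1) <=
     A * (rho * Num.sqrt 2 ^+ d) ^+ j * phi ((2 ^ j * N)%:R^-1)) ->
  (forall m, p m <= C / Num.sqrt N%:R ^+ d) ->
  (forall m, p m <= C / Num.sqrt m.+1%:R ^+ d) ->
  forall M, \sum_(0 <= m < M) u m * p m <=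
    C * (4 + 4 * A * Num.sqrt 2 ^+ d / (1 - rho)) /
    (Num.sqrt N%:R ^+ d * phi (N%:R^-1)).
Proof.
move=> N0 C0 A0 r0 r1 hphi hp1 hp2 M.
set th := Num.sqrt 2 ^+ d; set sN := Num.sqrt N%:R ^+ d.
have th0 : 0 < th by rewrite exprn_gt0 // sqrtr_gt0.
have Np : 0 < N%:R :> R by rewrite ltr0n.
have sN0 : 0 < sN by rewrite exprn_gt0 // sqrtr_gt0.
have pN := phi_pos N0.
have r2 : 1 - rho != 0 by rewrite gt_eqF // subr_gt0.
set B := C / (sN * phi N%:R^-1).
have B0 : 0 <= B by rewrite divr_ge0 // mulr_ge0 // ltW.
have block i j k (K : R) : (0 < k)%N -> (j <= k.+1)%N -> 0 <= K ->
    (forall m, (i <= m)%N -> p m <= K) ->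
    \sum_(i <= m < j) u m * p m <= K * (4 / phi (k%:R^-1)).
  move=> k0 jk K0 hK.
  apply: (@le_trans _ _ (K * \sum_(i <= m < j) u m)).
    rewrite mulr_sumr big_nat [leRHS]big_nat; apply: ler_sum => m /andP[im _].
    by rewrite mulrC ler_wpM2r // hK.
  rewrite ler_wpM2l //; apply: le_trans (u_mass k0).
  have [ij|ij] := leqP i j; last first.
    by rewrite big_geq ?(ltnW ij) //; exact: sumr_ge0.
  apply: le_trans (ler_sum_widen u_ge0 jk).
  by rewrite (big_cat_nat (leq0n i) ij) /= lerDr; exact: sumr_ge0.
have main k : \sum_(0 <= m < (2 ^ k * N).+1) u m * p m <=
    B * (4 + 4 * A * th * (rho * (1 - rho ^+ k) / (1 - rho))).
  elim: k => [|k IH].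
    rewrite expn0 mul1n expr0 subrr mulr0 mul0r mulr0 addr0.
    have := @block 0%N N.+1 N (C / sN) N0 (leqnn _) (divr_ge0 C0 (ltW sN0)) (fun m _ => hp1 m).
    suff -> : C / sN * (4 / phi N%:R^-1) = B * 4 by [].
    by rewrite /B; field; rewrite (gt_eqF pN) (gt_eqF sN0).
  have le2 : ((2 ^ k * N).+1 <= (2 ^ k.+1 * N).+1)%N.
    by rewrite ltnS leq_mul2r leq_exp2l // leqnSn orbT.
  rewrite (big_cat_nat (leq0n _) le2) /=.
  have Nk0 : (0 < 2 ^ k.+1 * N)%N by rewrite muln_gt0 expn_gt0.
  have Nk0' : (0 < 2 ^ k * N)%N by rewrite muln_gt0 expn_gt0.
  have K0 : 0 <= C / (th ^+ k * sN).
    by apply: divr_ge0 => //; apply: mulr_ge0; [exact/exprn_ge0/ltW|exact: ltW].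
  have hK m : ((2 ^ k * N).+1 <= m)%N -> p m <= C / (th ^+ k * sN).
    move=> hm; apply: le_trans (hp2 m) _; rewrite ler_wpM2l //.
    rewrite lef_pV2 ?posrE ?mulr_gt0 ?exprn_gt0 ?sqrtr_gt0 //.
    rewrite /th /sN -exprM mulnC exprM -exprMn.
    rewrite lerXn2r ?nnegrE ?mulr_ge0 ?exprn_ge0 ?sqrtr_ge0 //.
    rewrite -ler_sqr ?nnegrE ?mulr_ge0 ?exprn_ge0 ?sqrtr_ge0 //.
    rewrite exprMn exprAC !sqr_sqrtr // -natrX -natrM ler_nat; lia.
  have h := block _ _ (2 ^ k.+1 * N)%N _ Nk0 (leqnn _) K0 hK.
  apply: le_trans (lerD IH h) _.
  have pk := phi_pos Nk0.
  have hk : 4 / phi ((2 ^ k.+1 * N)%:R^-1) <= 4 * A * (rho * th) ^+ k.+1 / phi N%:R^-1.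
    rewrite ler_pdivrMr // mulrAC ler_pdivlMr //.
    by rewrite -!mulrA ler_wpM2l // mulrA.
  apply: le_trans (lerD (lexx _) (ler_wpM2l K0 hk)) _.
  rewrite le_eqVlt; apply/orP; left; apply/eqP.
  rewrite /B !exprS exprMn; field.
  have tk : 0 < th ^+ k by exact: exprn_gt0.
  by rewrite r2 (gt_eqF pN) (gt_eqF sN0) (gt_eqF tk).
have hM : (M <= (2 ^ M * N).+1)%N.
  by apply: leqW; apply: leq_trans (ltnW (ltn_expl M (ltnSn 1))) _; rewrite leq_pmulr.
apply: (@le_trans _ _ (\sum_(0 <= m < (2 ^ M * N).+1) u m * p m)).
  by apply: ler_sum_widen hM => m; rewrite mulr_ge0.
apply: le_trans (main M) _.
have -> : C * (4 + 4 * A * th / (1 - rho)) / (sN * phi N%:R^-1) =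
    B * (4 + 4 * A * th * (1 / (1 - rho))).
  by rewrite /B; field; rewrite r2 (gt_eqF pN) (gt_eqF sN0).
rewrite ler_wpM2l // lerD2l ler_wpM2l ?mulr_ge0 ?(ltW th0) //.
rewrite ler_wpM2r ?invr_ge0 ?subr_ge0 ?(ltW r1) //.
have : 0 <= rho ^+ M <= 1 by rewrite exprn_ge0 ?exprn_ile1 ?(ltW r0) ?(ltW r1).
by move=> /andP[? ?]; nra.
Qed.

End GreenSum.

(** * Laplace exponent and jump law *)

Section Laplace.
Variable R : realType.
Variables (phi : R -> R) (mu : {measure set (measurableTypeR R) -> \bar R}).
Hypothesis hphi : complete_bernstein phi mu.
Local Open Scope ereal_scope.

Let D : set (measurableTypeR R) := `]0%R, +oo[%classic.

Let mD : measurable D. Proof. exact: measurable_itv. Qed.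

Let Dpos (t : R) : D t -> (0 < t)%R.
Proof. by rewrite /D /= in_itv /= andbT. Qed.

Let mexp (a : R) : measurable_fun D (fun t : R => expR (a * t)).
Proof.
apply: measurableT_comp; first exact: measurable_expR.
exact: measurable_funM.
Qed.

Lemma phiE lam : (0 < lam)%R ->
  (phi lam)%:E = \int[mu]_(t in D) (1 - expR (- lam * t))%:E.
Proof.
case: hphi => _ _ h l0; rewrite h //; apply: eq_integral => t _.
by rewrite mulNr.
Qed.

Let mint (lam : R) : measurable_fun D (fun t : R => (1 - expR (- lam * t))%:E).
Proof. by apply/measurable_EFinP; apply: measurable_funB. Qed.

Let int_ge0 (lam t : R) : (0 <= lam)%R -> D t -> (0 <= 1 - expR (- lam * t))%R.
Proof.
move=> l0 /Dpos t0; rewrite subr_ge0 -[leRHS]expR0 ler_expR mulNr oppr_le0.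
by rewrite mulr_ge0 // ltW.
Qed.

Lemma phi_mono r s : (0 < r)%R -> (r <= s)%R -> (phi r <= phi s)%R.
Proof.
move=> r0 rs; have s0 : (0 < s)%R by exact: lt_le_trans rs.
rewrite -lee_fin !phiE //; apply: ge0_le_integral => //.
- by move=> t Dt; rewrite lee_fin; apply: int_ge0 => //; exact: ltW.
move=> t /Dpos t0; rewrite lee_fin lerD2l lerN2 ler_expR !mulNr lerN2.
by rewrite ler_wpM2r // ltW.
Qed.

(** Convexity of the exponential between -x and 0. *)
Lemma expR_chord (t x : R) : (0 <= t)%R -> (t <= 1)%R ->
  (t * (1 - expR (- x)) <= 1 - expR (- (t * x)))%R.
Proof.
move=> t0 t1.
have := @convex_expR R (@Itv01 R t t0 t1) (- x)%R 0%R.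
rewrite !convRE /= expR0 mulr0 addr0 mulr1 mulrN => h.
by rewrite /unstable.onem in h; lra.
Qed.

Lemma phi_conc t r : (0 < t)%R -> (t <= 1)%R -> (0 < r)%R ->
  (t * phi r <= phi (t * r))%R.
Proof.
move=> t0 t1 r0; rewrite -lee_fin EFinM !phiE //; last exact: mulr_gt0.
rewrite -ge0_integralZl_EFin //; last 2 first.
- by move=> x Dx; rewrite lee_fin; apply: int_ge0 => //; exact: ltW.
- exact: ltW.
apply: ge0_le_integral => //.
- by move=> x Dx; rewrite -EFinM lee_fin; apply: mulr_ge0; [exact: ltW|apply: int_ge0 => //; exact: ltW].
- exact: measurable_funeM.
move=> x Dx; rewrite -EFinM lee_fin !mulNr -mulrA; apply: expR_chord => //.
exact: ltW.
Qed.


Let measE (a b : R) m : measurable_fun D (fun t : R => (a * t ^+ m * expR (b * t))%:E).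
Proof.
by apply/measurable_EFinP; apply: measurable_funM => //; apply: measurable_funM.
Qed.

(** Summing the exponential series under the integral. The index starts at 1,
    whence the subtracted exponential, without which the integral would diverge
    when mu is infinite near 0. *)
Lemma jump_weight_gf (s : R) : (0 <= s)%R ->
  \sum_(0 <= m <oo) (s ^+ m.+1)%:E * jump_weight mu m.+1 =
  \int[mu]_(t in D) (expR ((s - 1) * t) - expR (- t))%:E.
Proof.
move=> s0.
transitivity (\int[mu]_(t in D) \sum_(0 <= m <oo)
    (s ^+ m.+1 / m.+1`!%:R * t ^+ m.+1 * expR (-1 * t))%:E).
  rewrite integral_nneseries //; last first.
    move=> m t /Dpos /ltW t0; rewrite lee_fin mulr_ge0 ?expR_ge0 //.
    by rewrite mulr_ge0 ?exprn_ge0 // divr_ge0 ?exprn_ge0.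
  apply: eq_eseriesr => m _; rewrite /jump_weight -ge0_integralZl_EFin //.
  - apply: eq_integral => t _; rewrite -EFinM; congr EFin.
    by rewrite mulN1r; ring.
  - move=> t /Dpos /ltW t0; rewrite lee_fin mulr_ge0 ?expR_ge0 //.
    by rewrite divr_ge0 ?exprn_ge0.
  - have := measE (m.+1`!%:R^-1) (-1) m.+1; congr (measurable_fun _ _).
    by apply/funext => t; rewrite mulN1r [(_^-1 * _)%R]mulrC.
  exact: exprn_ge0.
apply: eq_integral => t; rewrite inE => /Dpos /ltW t0.
apply: cvg_lim => //.
have h : ((series (exp_coeff (s * t)%R) N.+1 - 1) * expR (- t))%R @[N --> \oo] -->
    (expR ((s - 1) * t) - expR (- t))%R.
  have -> : (expR ((s - 1) * t) - expR (- t) = (expR (s * t) - 1) * expR (- t))%R.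
    by rewrite mulrBl mul1r mulrBl -expRD mul1r.
  apply: cvgM; last exact: cvg_cst.
  apply: cvgB; last exact: cvg_cst.
  by rewrite (cvg_shiftS (series (exp_coeff (s * t)%R))) /expR; exact: is_cvg_series_exp_coeff.
have -> : (fun n => \sum_(0 <= m < n)
      (s ^+ m.+1 / m.+1`!%:R * t ^+ m.+1 * expR (-1 * t))%:E) =
    EFin \o (fun N => (series (exp_coeff (s * t)%R) N.+1 - 1) * expR (- t))%R.
  apply/funext => n; rewrite /= /series /= sumEFin; congr EFin.
  rewrite big_nat_recl // /exp_coeff /= expr0 fact0 divr1 addrAC subrr add0r mulr_suml.
  by apply: eq_bigr => i _; rewrite mulN1r exprMn; ring.
exact: cvg_comp h _.
Qed.

Lemma jump_weight_gf1 :
  \sum_(0 <= m <oo) jump_weight mu m.+1 = (phi 1)%:E.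
Proof.
rewrite phiE //.
transitivity (\sum_(0 <= m <oo) (1 ^+ m.+1)%:E * jump_weight mu m.+1).
  by apply: eq_eseriesr => m _; rewrite expr1n mul1e.
rewrite jump_weight_gf //; apply: eq_integral => t _.
by rewrite subrr mul0r expR0 mulN1r.
Qed.

Lemma jump_weight_gf_lt1 (s : R) : (0 <= s)%R -> (s < 1)%R ->
  \sum_(0 <= m <oo) (s ^+ m.+1)%:E * jump_weight mu m.+1 =
  (phi 1 - phi (1 - s))%:E.
Proof.
move=> s0 s1; rewrite jump_weight_gf //.
have s2 : (0 < 1 - s)%R by rewrite subr_gt0.
have e : (phi 1)%:E = \int[mu]_(t in D) (expR ((s - 1) * t) - expR (- t))%:E
    + (phi (1 - s))%:E.
  rewrite !phiE // -ge0_integralD //.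
  - apply: eq_integral => t _; rewrite -EFinD; congr EFin.
    by rewrite mulN1r opprB; ring.
  - move=> t /Dpos t0; rewrite lee_fin subr_ge0 ler_expR mulrBl mul1r lerBrDr.
    by rewrite addNr mulr_ge0 // ltW.
  - apply/measurable_EFinP; apply: measurable_funB => //.
    by have := mexp (-1); congr (measurable_fun _ _); apply/funext => t; rewrite mulN1r.
  by move=> t Dt; rewrite lee_fin; apply: int_ge0 => //; exact: ltW.
by rewrite EFinB e addeK.
Qed.

(** If this integral of a positive function vanished, mu would be null on the
    positive half-line, and so would phi. *)
Lemma jump_weight1_gt0 : (0 < phi 1)%R -> 0 < jump_weight mu 1.
Proof.
move=> p1; rewrite lt0e; apply/andP; split; last first.
  apply: integral_ge0 => t /Dpos /ltW t0; rewrite lee_fin mulr_ge0 ?expR_ge0 //.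
  by rewrite divr_ge0 ?exprn_ge0.
apply/eqP => h0.
have mf : measurable_fun D (fun t : R => (t ^+ 1 / 1`!%:R * expR (- t))%:E).
  have := measE 1 (-1) 1; congr (measurable_fun _ _).
  by apply/funext => t; rewrite mulN1r mul1r divr1.
have := ae_eq_integral_abs mu mD mf; case=> h _.
have ae : ae_eq mu D (fun t : R => (t ^+ 1 / 1`!%:R * expR (- t))%:E) (cst 0).
  apply: h; rewrite -[RHS]h0; apply: eq_integral => t; rewrite inE => /Dpos /ltW t0.
  by rewrite gee0_abs // lee_fin mulr_ge0 ?expR_ge0 // divr_ge0 ?exprn_ge0.
have ae2 : ae_eq mu D (fun t : R => (1 - expR (- 1 * t))%:E) (cst 0).
  apply: filterS ae => t ht Dt; have := ht Dt; have t0 := Dpos Dt => /= -[].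
  by move/eqP; rewrite divr1 expr1 mulf_eq0 !gt_eqF ?expR_gt0.
have := phiE ltr01; rewrite (ae_eq_integral _ _ _ _ _ ae2) // integral0 => -[p0].
by rewrite p0 ltxx in p1.
Qed.
End Laplace.

(** * Laws of the walk and of the clock *)

Section Recursion.
Context {disp : measure_display} {Omega : measurableType disp} {R : realType}.
Variable P : probability Omega R.
Local Open Scope ereal_scope.

(** Decomposition according to the value of xi; s lists the values of interest
    and the last term collects the others. *)
Lemma prob_split (T : eqType) (xi : Omega -> T) (s : seq T) (A : set Omega) :
  (forall B : set T, measurable (xi @^-1` B)) -> measurable A -> uniq s ->
  P A = \sum_(y <- s) P (A `&` xi @^-1` [set y]) +
        P (A `&` xi @^-1` [set y | y \notin s]).
Proof.
move=> mxi mA us.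
have h : P (A `&` xi @^-1` [set y | y \in s]) =
    \sum_(y <- s) P (A `&` xi @^-1` [set y]).
  elim: s us => [_|y s IH /= /andP[ys us]].
    by rewrite big_nil (_ : _ `&` _ = set0) ?measure0 // -subset0 => w [].
  rewrite big_cons -IH // -measureU; first last.
  - by rewrite -subset0 => w /= [] [_ ->] [_]; rewrite (negbTE ys).
  - by apply: measurableI.
  - by apply: measurableI.
  congr (P _); rewrite -setIUr; congr (_ `&` _); apply/seteqP; split=> w /=.
    by rewrite inE => /orP[/eqP|]; [left|right].
  by rewrite inE => -[->|->]; rewrite ?eqxx ?orbT.
rewrite -h -measureU; first last.
- by rewrite -subset0 => w /= [] [_ ->] [_].
- by apply: measurableI.
- by apply: measurableI.
congr (P _); rewrite -setIUr -[LHS]setIT; congr (_ `&` _).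
by apply/seteqP; split=> w //= _; case: (boolP (xi w \in s)); [left|right].
Qed.

Section AdditiveWalk.
Variables (T : eqType) (U : Type) (xi : nat -> Omega -> T) (S : nat -> Omega -> U).
Variables (s : U -> seq T) (pre : U -> T -> U).
Hypothesis mxi : discrete_process xi.
Hypothesis mS : forall n z, measurable (S n @^-1` [set z]).
Hypothesis ind : mutually_independent P xi.
Hypothesis us : forall z, uniq (s z).
Hypothesis S_step : forall n z y, y \in s z ->
  S n.+1 @^-1` [set z] `&` xi n @^-1` [set y] =
  S n @^-1` [set pre z y] `&` xi n @^-1` [set y].
Hypothesis S_other : forall n z,
  P (S n.+1 @^-1` [set z] `&` xi n @^-1` [set y | y \notin s z]) = 0.
Hypothesis S_init : forall z, S 0%N @^-1` [set z] = setT \/ S 0%N @^-1` [set z] = set0.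

Let ev (I : {fset nat}) (B : nat -> set T) := \bigcap_(k in [set` I]) (xi k @^-1` B k).

Let mev I B : measurable (ev I B).
Proof. by apply: bigcap_measurableType => k _; exact: mxi. Qed.

Let indep_at n := forall z (I : {fset nat}) (B : nat -> set T),
  (forall k, k \in I -> (n <= k)%N) ->
  P (S n @^-1` [set z] `&` ev I B) =
  P (S n @^-1` [set z]) * \prod_(k <- I) P (xi k @^-1` B k).

Let recursion n : indep_at n -> forall z (I : {fset nat}) (B : nat -> set T),
  (forall k, k \in I -> (n < k)%N) ->
  P (S n.+1 @^-1` [set z] `&` ev I B) =
  (\sum_(y <- s z) P (S n @^-1` [set pre z y]) * P (xi n @^-1` [set y])) *
  \prod_(k <- I) P (xi k @^-1` B k).
Proof.
move=> IH z I B hI.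
rewrite (prob_split (mxi n) _ (us z)); last exact: measurableI.
rewrite [X in _ + X](_ : _ = 0) ?adde0; last first.
  apply/eqP; rewrite -measure_le0 -(S_other n z); apply: le_measure.
  - by apply/mem_set; apply: measurableI; [exact: measurableI|exact: mxi].
  - by apply/mem_set; apply: measurableI => //; exact: mxi.
  by move=> w [[]].
rewrite ge0_sume_distrl; last by move=> y _; rewrite mule_ge0.
rewrite big_seq [RHS]big_seq; apply: eq_bigr => y ys.
(* The event that the innovation n equals y joins the family of constraints, to
   which the induction hypothesis applies. *)
pose B' k := if k == n then [set y] else B k.
have nI : n \notin I by apply/negP => /hI; rewrite ltnn.
have -> : S n.+1 @^-1` [set z] `&` ev I B `&` xi n @^-1` [set y] =
    S n @^-1` [set pre z y] `&` ev (n |` I)%fset B'.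
  rewrite setIAC S_step // -setIA; congr (_ `&` _); apply/seteqP; split=> w.
    move=> [h1 h2] k /=; rewrite in_fset1U /B' => /orP[/eqP ->|kI].
      by rewrite eqxx.
    by rewrite gtn_eqF ?hI //; exact: h2.
  move=> h; split.
    by have := h n; rewrite /= fset1U1 /B' eqxx => /(_ isT).
  move=> k /= kI; have := h k; rewrite /= in_fset1U kI orbT => /(_ isT).
  by rewrite /B' gtn_eqF ?hI.
rewrite IH; last first.
  by move=> k; rewrite in_fset1U => /orP[/eqP ->//|/hI/ltnW].
rewrite -muleA; congr (_ * _).
rewrite big_fsetU1 //= /B' eqxx; congr (_ * _).
rewrite big_seq [RHS]big_seq; apply: eq_bigr => k kI.
by rewrite gtn_eqF ?hI.
Qed.

Let indep_all n : indep_at n.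
Proof.
elim: n => [|n IH] z I B hI.
  case: (S_init z) => ->; first by rewrite setTI probability_setT mul1e ind.
  by rewrite set0I measure0 mul0e.
have h0 : P (S n.+1 @^-1` [set z]) =
    \sum_(y <- s z) P (S n @^-1` [set pre z y]) * P (xi n @^-1` [set y]).
  have := @recursion n IH z fset0 B; rewrite big_seq_fset0 mule1 => <- //.
  by rewrite /ev set_fset0 bigcap_set0 setIT.
by rewrite h0; exact: recursion.
Qed.

(** A Markov chain driven by independent innovations, stated so as to cover both
    the lattice walk and the clock: among the innovations y listed in s z, S
    reaches z exactly from pre z y. Independence is given only as a product rule
    for events of single innovations, so the proof carries along the innovations
    of times >= n and shows by induction on n that the position at time n is
    independent of them. *)
Lemma walk_recursion n z : P (S n.+1 @^-1` [set z]) =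
  \sum_(y <- s z) P (S n @^-1` [set pre z y]) * P (xi n @^-1` [set y]).
Proof.
have := @recursion n (@indep_all n) z fset0 (fun=> setT).
rewrite big_seq_fset0 mule1 => <- //.
by rewrite /ev set_fset0 bigcap_set0 setIT.
Qed.

End AdditiveWalk.
End Recursion.

Section Laws.
Context {disp : measure_display} {Omega : measurableType disp} {R : realType}.
Variable P : probability Omega R.

(** The function on nat by which srw represents a lattice point. *)
Definition coords (d : nat) (x : 'rV[int]_d) (i : nat) : int :=
  if insub i is Some j then x 0 j else 0.

Lemma coordsE d (x : 'rV[int]_d) (i : 'I_d) : coords x i = x 0 i.
Proof. by rewrite /coords valK. Qed.

Lemma srw0 d (x : nat -> int) : srw R d x 0 = [forall i : 'I_d, x i == 0]%:R.
Proof.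
elim: d => [|d IH] /=; first by rewrite (_ : [forall _, _]) //; apply/forallP => -[].
rewrite /binsum big_ord1 bin0 mul1r subnn IH /= -natrM mulnb; congr (_%:R).
congr (nat_of_bool _); apply/andP/forallP => [[h1 /forallP h2] i|h].
  have := ltn_ord i; rewrite ltnS leq_eqVlt => /orP[/eqP ->//|hi].
  exact: (h2 (Ordinal hi)).
split; first exact: (h ord_max).
by apply/forallP => i; exact: (h (widen_ord (leqnSn d) i)).
Qed.

(** The walk satisfies the recursion srwS in time. That the steps are almost
    surely unit vectors follows by adding up their prescribed probabilities. *)
Lemma srw_law (d : nat) (Z : nat -> Omega -> 'rV[int]_d) (m : nat) (x : 'rV[int]_d) :
  (0 < d)%N -> simple_random_walk P Z ->
  P (Z m @^-1` [set x]) = (srw R d (coords x) m / d%:R ^+ m)%:E.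
Proof.
move=> d0 [mZ Z0 ind law].
set step := fun n w => Z n.+1 w - Z n w in ind law.
have mstep n (B : set 'rV[int]_d) : measurable (step n @^-1` B).
  have -> : step n @^-1` B =
      \bigcup_z (Z n @^-1` [set z] `&` Z n.+1 @^-1` [set y | B (y - z)]).
    apply/seteqP; split=> w; first by move=> h; exists (Z n w).
    by case=> z _ /= [<-].
  apply: countable_bigcupT_measurable; first exact: countableP.
  by move=> z; apply: measurableI; exact: mZ.
pose dirs : seq 'rV[int]_d :=
  [seq delta_mx 0 i | i <- index_enum 'I_d] ++ [seq - delta_mx 0 i | i <- index_enum 'I_d].
have udirs : uniq dirs.
  have dinj : injective (fun i : 'I_d => delta_mx 0 i : 'rV[int]_d).
    move=> i j /(congr1 (fun y : 'rV[int]_d => y 0 j)); rewrite !mxE !eqxx /=.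
    by case: eqP => [->|].
  rewrite cat_uniq; apply/and3P; split.
  - by rewrite map_inj_uniq ?index_enum_uniq.
  - apply/hasPn => _ /mapP[i _ ->]; apply/negP => /mapP[j _].
    move/(congr1 (fun y : 'rV[int]_d => y 0 i)); rewrite !mxE !eqxx /=.
    by case: (i == j).
  by rewrite map_inj_uniq ?index_enum_uniq // => i j /oppr_inj /dinj.
have sdirs (f : 'rV[int]_d -> \bar R) : (\sum_(y <- dirs) f y =
    \sum_(i < d) f (delta_mx 0%R i) + \sum_(i < d) f (- delta_mx 0 i)%R)%E.
  by rewrite big_cat !big_map.
(* Total probability of the 2d unit vectors. *)
have d2 : (2 * d)%:R != 0 :> R by rewrite pnatr_eq0; lia.
have other n : P (step n @^-1` [set y | y \notin dirs]) = 0%E.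
  have := prob_split P (mstep n) measurableT udirs.
  rewrite probability_setT setTI sdirs.
  under eq_bigr => i _ do rewrite setTI (law n i).1.
  under [X in (_ + X + _)%E]eq_bigr => i _ do rewrite setTI (law n i).2.
  rewrite !sumEFin !sumr_const card_ord -EFinD.
  have -> : (2 * d)%:R^-1 *+ d + (2 * d)%:R^-1 *+ d = 1 :> R.
    by rewrite -mulrnDr -[LHS]mulr_natr addnn -mul2n mulVf.
  have : P (step n @^-1` [set y | y \notin dirs]) \is a fin_num by exact: fin_num_measure.
  case: (P _) => // r _ /eqP; rewrite -EFinD eqe => /eqP h; congr EFin; lra.
elim: m x => [|m IH] x.
  rewrite expr0 divr1 srw0; case: forallP => [hx|hx].
    have x0 : x = 0.
      by apply/rowP => i; rewrite mxE; have /eqP := hx i; rewrite coordsE.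
    rewrite (_ : _ @^-1` _ = setT) ?probability_setT //.
    by rewrite -subTset => w _ /=; rewrite x0 Z0.
  rewrite (_ : _ @^-1` _ = set0) ?measure0 // -subset0 => w /= hw; apply: hx => i.
  by rewrite coordsE -hw Z0 mxE.
have -> : (P (Z m.+1 @^-1` [set x]) =
    \sum_(y <- dirs) P (Z m @^-1` [set (x - y)%R]) * P (step m @^-1` [set y]))%E.
  apply: (@walk_recursion _ _ _ P _ _ step Z (fun=> dirs) (fun z y => z - y)) => //.
  - move=> n z y _; apply/seteqP; split=> w /= [h1 h2]; split=> //.
      by rewrite -h1 -h2 /step subKr.
    by move: h2; rewrite /step h1 => /eqP; rewrite subr_eq => /eqP ->; rewrite addrC subrK.
  - move=> n z; apply/eqP; rewrite -measure_le0 -(other n); apply: le_measure.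
    + by apply/mem_set; apply: measurableI => //; exact: mZ.
    + exact/mem_set.
    + by move=> w [].
  move=> z; have [->|z0] := eqVneq z 0; [left|right].
    by rewrite -subTset => w _ /=; rewrite Z0.
  by rewrite -subset0 => w /=; rewrite Z0 => h; rewrite h eqxx in z0.
rewrite sdirs.
under eq_bigr => i _ do rewrite (law m i).1 IH -EFinM.
under [X in (_ + X)%E]eq_bigr => i _ do rewrite (law m i).2 IH -EFinM.
rewrite !sumEFin -EFinD srwS; congr EFin.
rewrite -big_split /= mulr_suml; apply: eq_bigr => i _.
have e1 : srw R d (coords (x - delta_mx 0 i)) m = srw R d (shift (coords x) i (-1)) m.
  apply: eq_srw => j jd; rewrite /shift (coordsE _ (Ordinal jd)) (coordsE _ (Ordinal jd)) !mxE eqxx /=.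
  by rewrite -val_eqE /=; case: eqP; rewrite ?subr0.
have e2 : srw R d (coords (x - - delta_mx 0 i)) m = srw R d (shift (coords x) i 1) m.
  apply: eq_srw => j jd; rewrite /shift (coordsE _ (Ordinal jd)) (coordsE _ (Ordinal jd)) !mxE eqxx /=.
  by rewrite -val_eqE /= opprK; case: eqP; rewrite ?addr0.
rewrite e1 e2 exprS natrM; field.
by rewrite expf_neq0 pnatr_eq0 -lt0n d0.
Qed.
End Laws.

Section Clock.
Context {disp : measure_display} {Omega : measurableType disp} {R : realType}.
Variable P : probability Omega R.
Variable mu : {measure set (measurableTypeR R) -> \bar R}.

(** The law of the jumps; the mass at 0 vanishes because the masses of the
    positive integers add up to 1, which is jump_law. *)
Definition jump_prob (m : nat) : R :=
  if m is _.+1 then fine (jump_weight mu m) else 0.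

Definition clock (J : nat -> Omega -> nat) (n : nat) (w : Omega) : nat :=
  \sum_(k < n) J k w.

Variable J : nat -> Omega -> nat.
Hypothesis mJ : discrete_process J.
Hypothesis indJ : mutually_independent P J.
Hypothesis lawJ : forall k m : nat, (1 <= m)%N ->
  P (J k @^-1` [set m]) = jump_weight mu m.
Hypothesis total : (\sum_(0 <= m <oo) jump_weight mu m.+1 = 1)%E.

Lemma clockS n w : clock J n.+1 w = (clock J n w + J n w)%N.
Proof. by rewrite /clock big_ord_recr. Qed.

Lemma clock_step n m : clock J n.+1 @^-1` [set m] =
  \bigcup_(k in [set k | (k <= m)%N]) (clock J n @^-1` [set (m - k)%N] `&` J n @^-1` [set k]).
Proof.
apply/seteqP; split=> w /=.
  by rewrite clockS => h; exists (J n w); rewrite -h /= ?leq_addl // addnK.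
by case=> k /= km [h1 h2]; rewrite clockS h1 h2 subnK.
Qed.

(** The events of the clock belong to the sigma-algebra of the jumps, so they
    are independent of those of Z. *)
Lemma sigma_clock n m : sigma_of J (clock J n @^-1` [set m]).
Proof.
have sg : sigma_algebra setT (sigma_of J) by exact: smallest_sigma_algebra.
elim: n m => [|n IH] m.
  have -> : clock J 0 @^-1` [set m] = J 0%N @^-1` [set _ | m = 0%N].
    by apply/seteqP; split=> w /=; rewrite /clock big_ord0.
  by apply: sub_sigma_algebra; exists 0%N, [set _ | m = 0%N].
rewrite clock_step bigcup_mkcond; case: sg => s0 sC sU; apply: (sU) => k.
case: ifPn => _ //.
rewrite -(setCK (_ `&` _)) -[X in sigma_of _ X]setTD; apply: (sC).
rewrite setCI -bigcup2E; apply: (sU) => -[|[|i]] /=.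
- by rewrite -setTD; apply: (sC); exact: IH.
- by rewrite -setTD; apply: (sC); apply: sub_sigma_algebra; exists n, [set k].
by [].
Qed.

Lemma sigma_of_measurable (T : Type) (X : nat -> Omega -> T) A :
  discrete_process X -> sigma_of X A -> measurable A.
Proof.
move=> mX; apply: smallest_sub; first exact: sigma_algebra_measurable.
by move=> _ [n [B ->]]; exact: mX.
Qed.

Lemma mclock n m : measurable (clock J n @^-1` [set m]).
Proof. by apply: (sigma_of_measurable mJ); exact: sigma_clock. Qed.

Lemma prob_bigcup (F : nat -> set Omega) : (forall m, measurable (F m)) ->
  trivIset setT F -> P (\bigcup_m F m) = (\sum_(0 <= m <oo) P (F m))%E.
Proof.
move=> mF tF; rewrite measure_bigcup //; apply: eq_eseriesl => m.
by rewrite in_setT.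
Qed.

Lemma jump_law k m : P (J k @^-1` [set m]) = (jump_prob m)%:E.
Proof.
case: m => [|m]; last first.
  by rewrite /jump_prob -(lawJ k) // fineK //; apply: fin_num_measure; exact: mJ.
have mm m : measurable (J k @^-1` [set m]) by exact: mJ.
have : P setT = (\sum_(0 <= m <oo) P (J k @^-1` [set m]))%E.
  rewrite -prob_bigcup //.
    by congr (P _); apply/esym; rewrite -subTset => w _; exists (J k w).
  by apply/trivIsetP => i j _ _ ij; rewrite -subset0 => w /= [] /= -> /eqP; rewrite (negbTE ij).
rewrite probability_setT nneseries_recl // -(nneseries_addn 1%N) //.
have -> : (\sum_(0 <= m <oo) P (J k @^-1` [set (m + 1)%N]) = 1)%E.
  by rewrite -[RHS]total; apply: eq_eseriesr => m _; rewrite addn1 lawJ.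
have : P (J k @^-1` [set 0%N]) \is a fin_num by exact: fin_num_measure.
case: (P _) => // r _ /eqP; rewrite -EFinD eqe => /eqP h; congr EFin; rewrite /jump_prob; lra.
Qed.

Lemma jump_prob_ge0 m : 0 <= jump_prob m.
Proof. by rewrite -lee_fin -(jump_law 0). Qed.

Lemma jump_prob_le1 m : jump_prob m <= 1.
Proof. by rewrite -lee_fin -(jump_law 0) probability_le1. Qed.

Lemma clock_law n m : P (clock J n @^-1` [set m]) = (conv_pow jump_prob n m)%:E.
Proof.
elim: n m => [|n IH] m.
  have [->|m0] := eqVneq m 0%N.
    rewrite (_ : _ @^-1` _ = setT) ?probability_setT //.
    by rewrite -subTset => w _ /=; rewrite /clock big_ord0.
  rewrite (_ : _ @^-1` _ = set0) ?measure0 /= ?(negbTE m0) //.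
  rewrite -subset0 => w /=; rewrite /clock big_ord0 => h.
  by rewrite h eqxx in m0.
have -> : (P (clock J n.+1 @^-1` [set m]) = \sum_(k <- index_iota 0 m.+1)
    P (clock J n @^-1` [set (m - k)%N]) * P (J n @^-1` [set k]))%E.
  apply: (@walk_recursion _ _ _ P _ _ J (clock J) (fun m => index_iota 0 m.+1) (fun m k => (m - k)%N)) => //.
  - by move=> *; exact: mclock.
  - by move=> *; exact: iota_uniq.
  - move=> i z y; rewrite mem_index_iota ltnS /= => yz.
    apply/seteqP; split=> w /= [h1 h2]; split=> //.
      by rewrite -h1 -h2 clockS addnK.
    by rewrite clockS h1 h2 subnK.
  - move=> i z; rewrite (_ : _ `&` _ = set0) ?measure0 // -subset0 => w /= [h].
    by rewrite mem_index_iota ltnS /= -h clockS leq_addl.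
  move=> z; have [->|z0] := eqVneq z 0%N; [left|right].
    by rewrite -subTset => w _ /=; rewrite /clock big_ord0.
  rewrite -subset0 => w /=; rewrite /clock big_ord0 => h.
  by rewrite h eqxx in z0.
rewrite /= -sumEFin; apply: eq_bigr => k _.
by rewrite IH jump_law -EFinM mulrC.
Qed.

Lemma green_series (d : nat) (Z X : nat -> Omega -> 'rV[int]_d) (x : 'rV[int]_d)
    (p : nat -> R) :
  discrete_process Z -> independent_processes P Z J ->
  (forall n w, X n w = Z (clock J n w) w) ->
  (forall m, P (Z m @^-1` [set x]) = (p m)%:E) ->
  green P X x = (\sum_(0 <= m <oo) (renewal jump_prob m * p m)%:E)%E.
Proof.
move=> mZ indZ XE pE.
have p0 m : 0 <= p m by rewrite -lee_fin -pE.
have c0 n m : 0 <= conv_pow jump_prob n m.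
  by apply: conv_pow_ge0; exact: jump_prob_ge0.
have XU n : X n @^-1` [set x] =
    \bigcup_m (Z m @^-1` [set x] `&` clock J n @^-1` [set m]).
  apply/seteqP; split=> w /=; first by rewrite XE => h; exists (clock J n w).
  by case=> m _ [/= h1 h2]; rewrite XE h2.
have mZT n m : measurable (Z m @^-1` [set x] `&` clock J n @^-1` [set m]).
  by apply: measurableI; [exact: mZ|exact: mclock].
have mX n : measurable (X n @^-1` [set x]).
  by rewrite XU; exact: bigcupT_measurable.
have PX n : P (X n @^-1` [set x]) =
    (\sum_(0 <= m <oo) (conv_pow jump_prob n m * p m)%:E)%E.
  rewrite XU prob_bigcup //; last first.
    apply/trivIsetP => i j _ _ ij; rewrite -subset0 => w /= [[_ h1] [_ h2]].
    by move: ij; rewrite -h1 h2 eqxx.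
  apply: eq_eseriesr => m _; rewrite indZ; first by rewrite pE clock_law -EFinM mulrC.
    by apply: sub_sigma_algebra; exists m, [set x].
  exact: sigma_clock.
rewrite /green integral_nneseries //; last first.
  by move=> n; apply/measurable_EFinP; exact: measurable_indic.
transitivity (\sum_(0 <= n <oo) \sum_(0 <= m <oo) (conv_pow jump_prob n m * p m)%:E)%E.
  by apply: eq_eseriesr => n _; rewrite -PX -[X in P X]setIT; apply: integral_indic.
rewrite nneseries_interchange; last by move=> n m; rewrite lee_fin mulr_ge0.
apply: eq_eseriesr => m _.
rewrite (@nneseries_split _ _ 0%N m.+1); last by move=> n _; rewrite lee_fin mulr_ge0.
rewrite eseries0 ?adde0; last first.
  by move=> n mn _; rewrite conv_pow_small ?mul0r.
by rewrite add0n sumEFin -mulr_suml.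
Qed.
End Clock.

(** * The Green function *)

Section Assembly.
Variable R : realType.

Lemma jump_prob_gf (phi : R -> R) mu (s : R) : complete_bernstein phi mu ->
  phi 1 = 1 -> (forall m, 0 <= jump_prob mu m) ->
  (forall m, jump_weight mu m.+1 = (jump_prob mu m.+1)%:E) ->
  0 <= s -> s < 1 ->
  gf (jump_prob mu) s N @[N --> \oo] --> 1 - phi (1 - s).
Proof.
move=> hphi phi1 c0 jw s0 s1.
have h := jump_weight_gf_lt1 hphi s0 s1; rewrite phi1 in h.
rewrite -(cvg_shiftS (gf (jump_prob mu) s)).
have e N : (gf (jump_prob mu) s N.+1)%:E =
    (\sum_(0 <= m < N) (s ^+ m.+1)%:E * jump_weight mu m.+1)%E.
  rewrite /gf big_nat_recl // mul0r add0r -sumEFin; apply: eq_bigr => m _.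
  by rewrite jw -EFinM mulrC.
have H : (gf (jump_prob mu) s N.+1)%:E @[N --> \oo] --> (1 - phi (1 - s))%:E.
  under eq_fun do rewrite e.
  rewrite -h; apply: is_cvg_nneseries => m _ _.
  by rewrite jw -EFinM lee_fin mulr_ge0 ?exprn_ge0.
by move/fine_cvgP: H => [_]; exact.
Qed.

(** This K makes [0, N] carry a small part of the mass of u seen at the scale
    KN. *)
Lemma phi_ratio_large (phi : R -> R) (a g : R) : 0 < a -> 0 < g ->
  (forall r, 0 < r -> r <= 1 -> 0 < phi r) ->
  (forall r s : R, 0 < r -> r <= s -> s <= 1 ->
      a * (s / r) `^ g <= phi s / phi r) ->
  exists2 K, (0 < K)%N & forall N, (0 < N)%N ->
    16 * phi ((K * N)%:R^-1) <= phi (N%:R^-1).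
Proof.
move=> a0 g0 pos h; set y := (16 / a) `^ g^-1.
exists (Num.truncn y).+1 => // N N0; set K := (Num.truncn y).+1.
have Ky : y <= K%:R by rewrite ltW // truncnS_gt.
have Np : 0 < N%:R :> R by rewrite ltr0n.
have KNp : 0 < (K * N)%:R :> R by rewrite ltr0n muln_gt0.
have r0 : 0 < (K * N)%:R^-1 :> R by rewrite invr_gt0.
have rs : (K * N)%:R^-1 <= N%:R^-1 :> R by rewrite lef_pV2 ?posrE // ler_nat leq_pmull.
have s1 : N%:R^-1 <= 1 :> R by rewrite invf_le1 // ler1n.
have := h _ _ r0 rs s1; rewrite ler_pdivlMr; last by rewrite pos // (le_trans rs).
apply: le_trans; rewrite ler_wpM2r //; first by rewrite ltW // pos // (le_trans rs).
have -> : N%:R^-1 / (K * N)%:R^-1 = K%:R :> R.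
  by rewrite invrK natrM mulrCA mulVf ?gt_eqF // mulr1.
rewrite mulrC -ler_pdivrMr //.
have -> : 16 / a = y `^ g.
  by rewrite /y -powRrM mulVf ?gt_eqF // powRr1 // divr_ge0 // ltW.
by apply: ge0_ler_powR; rewrite ?nnegrE ?powR_ge0 // ltW.
Qed.

(** Here sqrt 2 ^ d = 2^(d/2). For d <= 2 take rho = 2^(gamma2 - d/2); for d >=
    3, concavity gives phi(1/N) <= 2^j phi(1/(2^j N)) and rho = 2^(1 - d/2) is
    below 1. *)
Lemma phi_dyadic_growth (phi : R -> R) (d : nat) :
  (forall r, 0 < r -> r <= 1 -> 0 < phi r) ->
  (forall t r, 0 < t -> t <= 1 -> 0 < r -> t * phi r <= phi (t * r)) ->
  ((d <= 2)%N -> exists g a : R, [/\ g < d%:R / 2, 0 < a &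
    forall r s : R, 0 < r -> r <= s -> s <= 1 -> phi s / phi r <= a * (s / r) `^ g]) ->
  exists A rho : R, [/\ 0 <= A, 0 < rho, rho < 1 & forall N j, (0 < N)%N ->
    phi (N%:R^-1) <= A * (rho * Num.sqrt 2 ^+ d) ^+ j * phi ((2 ^ j * N)%:R^-1)].
Proof.
move=> pos conc h; set th := Num.sqrt 2 ^+ d.
have th0 : 0 < th by rewrite exprn_gt0 // sqrtr_gt0.
have common N j : (0 < N)%N -> [/\ 0 < (2 ^ j * N)%:R^-1 :> R,
    (2 ^ j * N)%:R^-1 <= N%:R^-1 :> R, N%:R^-1 <= 1 :> R &
    N%:R^-1 / (2 ^ j * N)%:R^-1 = 2 ^+ j :> R].
  move=> N0; have Np : 0 < N%:R :> R by rewrite ltr0n.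
  have jp : (0 < 2 ^ j)%N by rewrite expn_gt0.
  split.
  - by rewrite invr_gt0 ltr0n muln_gt0 jp.
  - by rewrite lef_pV2 ?posrE ?ltr0n ?muln_gt0 ?jp // ler_nat leq_pmull.
  - by rewrite invf_le1 // ler1n.
  by rewrite invrK natrM mulrCA mulVf ?gt_eqF // mulr1 natrX.
have [d2|d3] := leqP d 2.
  have [g [a [gd a0 hu]]] := h d2.
  exists a, (2 `^ g / th); split=> [||| N j N0].
  - exact: ltW.
  - by rewrite divr_gt0 // powR_gt0.
  - rewrite ltr_pdivrMr // mul1r /th -powR12_sqrt // -powR_mulrn ?powR_ge0 //.
    rewrite -powRrM /powR pnatr_eq0 /= ltr_expR ltr_pM2r ?ln_gt0 ?ltr1n //.
    by rewrite mulrC.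
  have [r0 rs s1 e] := common N j N0.
  have := hu _ _ r0 rs s1; rewrite e ler_pdivrMr ?pos ?(le_trans rs) // => hh.
  rewrite divfK ?gt_eqF //.
  suff -> : (2 `^ g) ^+ j = (2 ^+ j) `^ g by [].
  by rewrite -(powR_mulrn _ (powR_ge0 2 g)) -(powR_mulrn _ (ler0n _ 2)) -!powRrM mulrC.
have th2 : 2 < th.
  rewrite -ltr_sqr ?nnegrE ?(ltW th0) // /th exprAC sqr_sqrtr //.
  rewrite -(subnKC d3) exprD.
  have : 1 <= 2 ^+ (d - 3) :> R by rewrite exprn_ege1 // ler1n.
  lra.
exists 1, (2 / th); split=> [||| N j N0] //.
- by rewrite divr_gt0.
- by rewrite ltr_pdivrMr ?mul1r.
have [r0 rs s1 e] := common N j N0.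
rewrite mul1r divfK ?gt_eqF //.
have p2 : 0 < 2 ^+ j :> R by rewrite exprn_gt0.
have Np : 0 < N%:R^-1 :> R by exact: lt_le_trans rs.
have := @conc (2 ^+ j)^-1 N%:R^-1; rewrite invr_gt0 p2 => /(_ isT).
rewrite invf_le1 // exprn_ege1 ?ler1n // => /(_ isT Np).
by rewrite natrM invfM natrX mulrC ler_pdivrMr // mulrC.
Qed.

Lemma enorm_sqrt d (x : 'rV[int]_d) :
  enorm R x = Num.sqrt (\sum_(i < d) `|x 0%R i| ^ 2)%N%:R.
Proof.
rewrite /enorm natr_sum; congr Num.sqrt; apply: eq_bigr => i _.
by rewrite natrX natr_absz intr_norm real_normK ?num_real.
Qed.

Lemma sqnorm_coords d (x : 'rV[int]_d) :
  sqnorm R d (coords x) = (\sum_(i < d) `|x 0%R i| ^ 2)%N%:R.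
Proof.
rewrite /sqnorm natr_sum; apply: eq_bigr => i _.
by rewrite coordsE natrX natr_absz intr_norm real_normK ?num_real.
Qed.
End Assembly.

Theorem theorem4p3 (R : realType) (disp : measure_display)
    (Omega : measurableType disp) (P : probability Omega R)
    (d : nat) (hd : (1 <= d)%N)
    (phi : R -> R) (mu : {measure set (measurableTypeR R) -> \bar R})
    (hphi : complete_bernstein phi mu) (hphi1 : phi 1 = 1)
    (X : nat -> Omega -> 'rV[int]_d)
    (hX : subordinate_random_walk P mu X)
    (gamma1 a1 : R) (hgamma1 : 0 < gamma1 < 1) (ha1 : 0 < a1)
    (hlower : forall r s : R, 0 < r -> r <= s -> s <= 1 ->
      a1 * (s / r) `^ gamma1 <= phi s / phi r)
    (hupper : (d <= 2)%N -> exists gamma2 a2 : R,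
      [/\ gamma1 <= gamma2 < 1, gamma2 < d%:R / 2, 0 < a2
        & forall r s : R, 0 < r -> r <= s -> s <= 1 ->
            phi s / phi r <= a2 * (s / r) `^ gamma2]) :
  exists c1 c2 : R, [/\ 0 < c1, 0 < c2
    & forall x : 'rV[int]_d, 1 <= enorm R x ->
        ((c1 / (enorm R x ^+ d * phi (enorm R x ^- 2)))%:E <= green P X x)%E /\
        (green P X x <= (c2 / (enorm R x ^+ d * phi (enorm R x ^- 2)))%:E)%E].
Proof.
have conc t r : 0 < t -> t <= 1 -> 0 < r -> t * phi r <= phi (t * r).
  exact: (phi_conc hphi).
have mono r s : 0 < r -> r <= s -> phi r <= phi s by exact: (phi_mono hphi).
have pos r : 0 < r -> r <= 1 -> 0 < phi r.
  by move=> r0 r1; have := conc r 1 r0 r1 ltr01; rewrite hphi1 !mulr1; exact: lt_le_trans.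
have total : (\sum_(0 <= m <oo) jump_weight mu m.+1 = 1)%E.
  by rewrite (jump_weight_gf1 hphi) hphi1.
case: hX => Z [J [hZ [mJ indJ] lawJ indZJ XE]].
have mZ : discrete_process Z by case: hZ.
pose c := jump_prob mu.
have c0 m : 0 <= c m := jump_prob_ge0 mJ lawJ total m.
have jw m : jump_weight mu m.+1 = (c m.+1)%:E.
  by rewrite -(jump_law mJ lawJ total 0) lawJ.
have c1p : 0 < c 1%N.
  by rewrite -lte_fin -jw; apply: (jump_weight1_gt0 hphi); rewrite hphi1.
have c1le : c 1%N <= 1 := jump_prob_le1 mJ lawJ total 1.
have cgf s : 0 <= s -> s < 1 -> gf c s N @[N --> \oo] --> 1 - phi (1 - s).
  exact: jump_prob_gf.
have mono' r s : 0 < r -> r <= s -> s <= 1 -> phi r <= phi s by move=> *; exact: mono.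
have conc' t r : 0 < t -> t <= 1 -> 0 < r -> r <= 1 -> t * phi r <= phi (t * r).
  by move=> *; exact: conc.
have /andP[g0 _] := hgamma1.
have [K K0 hK] := phi_ratio_large ha1 g0 pos hlower.
have hupper' : (d <= 2)%N -> exists g a : R, [/\ g < d%:R / 2, 0 < a &
    forall r s : R, 0 < r -> r <= s -> s <= 1 -> phi s / phi r <= a * (s / r) `^ g].
  by move=> /hupper[g [a [_ ? ? ?]]]; exists g, a.
have [A [rho [A0 rho0 rho1 hA]]] := phi_dyadic_growth pos conc hupper'.
have [Cd Cd0 hdiag] := srw_le_time R hd.
have [Co Co0 hoff] := srw_le_space R hd.
have [cl [M [cl0 hlow]]] := srw_lower hd (ler01 : 0 <= 1 :> R).
(* From time M0 N on, both conditions of the lower heat kernel bound hold: m >=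
   M and |x|^2 <= m. *)
pose M0 := (Num.truncn `|M|).+1.
have M0M : M <= M0%:R by rewrite (le_trans (ler_norm _)) // ltW // truncnS_gt.
pose C := Cd + Co; have C0 : 0 < C by rewrite addr_gt0.
pose th : R := Num.sqrt 2 ^+ d.
have th0 : 0 < th by rewrite exprn_gt0 // sqrtr_gt0.
(* All times used in the lower bound satisfy m + 1 <= 16 K M0 N. *)
pose s16 : R := Num.sqrt (16 * K * M0)%:R ^+ d.
have s160 : 0 < s16 by rewrite exprn_gt0 // sqrtr_gt0 ltr0n !muln_gt0 K0.
exists (cl / s16 * (c 1%N / 4)), (C * (4 + 4 * A * th / (1 - rho))); split.
- by rewrite mulr_gt0 // divr_gt0.
- rewrite mulr_gt0 // ltr_wpDr // divr_ge0 ?mulr_ge0 ?(ltW th0) //.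
  by rewrite subr_ge0 ltW.
move=> x; rewrite enorm_sqrt.
set N := (\sum_(i < d) `|x 0%R i| ^ 2)%N => hN.
have N0 : (0 < N)%N.
  by rewrite lt0n; apply/eqP => N0; move: hN; rewrite N0 sqrtr0 ler10.
have Np : 0 < N%:R :> R by rewrite ltr0n.
have -> : Num.sqrt N%:R ^- 2 = N%:R^-1 :> R by rewrite sqr_sqrtr.
pose p m : R := srw R d (coords x) m / d%:R ^+ m.
have p0 m : 0 <= p m by rewrite divr_ge0 ?srw_ge0 ?exprn_ge0.
have -> : green P X x = (\sum_(0 <= m <oo) (renewal c m * p m)%:E)%E.
  apply: (green_series mJ indJ lawJ total mZ indZJ) => [n w|m]; first exact: XE.
  exact: srw_law.
have u0 := renewal_ge0 c0.
have pN : 0 < phi N%:R^-1 by rewrite pos ?invr_gt0 // invf_le1 // ler1n.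
have sN0 : 0 < Num.sqrt N%:R ^+ d :> R by rewrite exprn_gt0 // sqrtr_gt0.
have nsqN : sqnorm R d (coords x) = N%:R by exact: sqnorm_coords.
split; last first.
  apply: lime_le; first by apply: is_cvg_nneseries => m _ _; rewrite lee_fin mulr_ge0.
  apply: nearW => L; rewrite sumEFin lee_fin.
  apply: (@weighted_sum_le _ (renewal c) p phi) => //.
  - by move=> k k0; rewrite pos ?invr_gt0 ?ltr0n // invf_le1 ?ler1n ?ltr0n.
  - by move=> k k0; exact: renewal_mass_le.
  - exact: ltW.
  - by move=> j; exact: hA.
  - move=> m; have := hoff (coords x) m; rewrite nsqN => /(_ Np) /le_trans; apply.
    by rewrite ler_wpM2r ?invr_ge0 ?(ltW sN0) // /C lerDr ltW.
  move=> m; have /le_trans := hdiag (coords x) m; apply.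
  by rewrite ler_wpM2r ?invr_ge0 ?exprn_ge0 ?sqrtr_ge0 // /C lerDl ltW.
pose N' := (M0 * N)%N.
have N'0 : (0 < N')%N by rewrite muln_gt0.
have N'N : (N <= N')%N by rewrite leq_pmull.
pose L := (14 * K * N')%N.
have NL : (N'.+1 <= L.+1)%N by rewrite ltnS /L leq_pmull // muln_gt0.
pose b := odd `|(\sum_(i < d) coords x i)%R|.
have hpar := renewal_parity c0 (erefl : c 0%N = 0) b c1le NL.
have hmass := renewal_mass_ge c0 erefl pos mono' conc' cgf K0 N'0 (hK _ N'0).
apply: le_trans (nneseries_lim_ge L.+2 _); last by move=> m _; rewrite lee_fin mulr_ge0.
rewrite sumEFin lee_fin.
have LN : (L.+2 <= 16 * K * M0 * N)%N.
  have -> : (16 * K * M0 * N = L + 2 * (K * N'))%N by rewrite /L /N'; ring.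
  by rewrite -addn2 leq_add2l leq_pmulr // muln_gt0 K0.
have hp m : (N'.+1 <= m)%N -> (m < L.+2)%N -> odd m == b -> 
    cl / (s16 * Num.sqrt N%:R ^+ d) <= p m.
  move=> m1 m2 /eqP mb.
  have h : cl * d%:R ^+ m / Num.sqrt m.+1%:R ^+ d <= srw R d (coords x) m.
    apply: hlow.
    - apply: (le_trans M0M); rewrite ler_nat.
      by apply: leq_trans (ltnW m1); rewrite /N' leq_pmulr.
    - by rewrite nsqN mul1r ler_nat; apply: leq_trans (ltnW m1).
    move: mb; rewrite /b; move: (\sum_(i < d) _)%R => S mb; clear -mb.
    have hS := odd_double_half `|S|; have hm := odd_double_half m.
    by apply/dvdzP; have [S0|S0] := ger0P S;
      [exists (m./2%:Z - `|S|./2%:Z)|exists (m./2%:Z + `|S|./2%:Z + odd m)]; lia.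
  have dm : 0 < d%:R ^+ m :> R by rewrite exprn_gt0 // ltr0n.
  rewrite /p ler_pdivlMr //; apply: le_trans h.
  rewrite mulrAC ler_wpM2l ?mulr_ge0 ?(ltW cl0) ?(ltW dm) //.
  have sm : 0 < Num.sqrt m.+1%:R :> R by rewrite sqrtr_gt0.
  have smd : 0 < Num.sqrt m.+1%:R ^+ d :> R by exact: exprn_gt0.
  have sNs : 0 < s16 * Num.sqrt N%:R ^+ d by exact: mulr_gt0.
  rewrite lef_pV2 ?posrE //.
  rewrite /s16 -exprMn -sqrtrM // -natrM lerXn2r ?nnegrE ?sqrtr_ge0 //.
  by rewrite ler_sqrt // ler_nat (leq_trans m2).
apply: (@le_trans _ _ (\sum_(N'.+1 <= m < L.+2 | odd m == b) renewal c m * p m)).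
  apply: (@le_trans _ _ (cl / (s16 * Num.sqrt N%:R ^+ d) *
      \sum_(N'.+1 <= m < L.+2 | odd m == b) renewal c m)).
    have Np' : 0 < N'%:R :> R by rewrite ltr0n.
    have pN' : 0 < phi N'%:R^-1 by rewrite pos ?invr_gt0 // invf_le1 // ler1n.
    have q : (phi N%:R^-1)^-1 <= (phi N'%:R^-1)^-1.
      rewrite lef_pV2 ?posrE //; apply: mono; first by rewrite invr_gt0.
      by rewrite lef_pV2 ?posrE // ler_nat.
    have e : cl / s16 * (c 1%N / 4) / (Num.sqrt N%:R ^+ d * phi N%:R^-1) =
       cl / (s16 * Num.sqrt N%:R ^+ d) * (c 1%N / 2 * (2 * phi N%:R^-1)^-1).
      by field; rewrite (gt_eqF pN) (gt_eqF sN0) (gt_eqF s160).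
    apply: (le_trans (_ : _ <= cl / (s16 * Num.sqrt N%:R ^+ d) * (c 1%N / 2 * (2 * phi N%:R^-1)^-1))).
      by rewrite le_eqVlt; apply/orP; left; apply/eqP; exact: e.
    have k0 : 0 <= cl / (s16 * Num.sqrt N%:R ^+ d).
      by apply: divr_ge0; [exact: ltW|exact/ltW/mulr_gt0].
    apply: (ler_wpM2l k0).
    apply: le_trans hpar; rewrite ler_wpM2l ?divr_ge0 ?(ltW c1p) //.
    by apply: le_trans hmass; rewrite !invfM ler_wpM2l.
  rewrite mulr_sumr big_nat_cond [leRHS]big_nat_cond; apply: ler_sum => m.
  by move=> /andP[/andP[m1 m2] mb]; rewrite mulrC ler_wpM2l // hp.
rewrite [leRHS](@big_cat_nat _ _ _ N'.+1) //=; last by rewrite leqW.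
apply: ler_wpDl; first by apply: sumr_ge0 => m _; rewrite mulr_ge0.
rewrite big_mkcond; apply: ler_sum => m _; case: ifP => // _.
by rewrite mulr_ge0.
Qed.
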